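(* Let $\mathfrak{X} = (X_i)_{i \in \mathbb{N}}$ be a strongly Rayleigh sequence of Bernoulli (i.e. $\{0,1\}$-valued) random variables. Then the tail $\sigma$-field $\mathcal{T}(\mathfrak{X})$ is trivial: $\mathbb{P}(E) \in \{0,1\}$ for every $E \in \mathcal{T}(\mathfrak{X})$.
   Context: A probability measure $\mu$ on $\{0,1\}^n$ is strongly Rayleigh if its generating polynomial $f_\mu(z_1,\dots,z_n) = \sum_{I \in \{0,1\}^n} \mu(I) \prod_{i=1}^n z_i^{I_i}$ is real stable, i.e. it has no zeros in $\mathbb{H}^n$, where $\mathbb{H}$ is the open upper half-plane of $\mathbb{C}$. A vector of Bernoulli random variables is strongly Rayleigh if its law is strongly Rayleigh. A sequence $(X_i)_{i\in\mathbb{N}}$ of Bernoulli random variables is strongly Rayleigh if $(X_1,\dots,X_n)$ is strongly Rayleigh for every $n \in \mathbb{N}$. The tail $\sigma$-field of $\mathfrak{X}$ is $\mathcal{T}(\mathfrak{X}) = \bigcap_{n=1}^\infty \sigma(X_i : i \geq n)$. *)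

(* Defs.v *)
From HB Require Import structures.
From mathcomp Require Import all_boot all_order all_algebra.
From mathcomp Require complex mpoly.

Set Implicit Arguments.
Unset Strict Implicit.
Unset Printing Implicit Defensive.

Import GRing.Theory Num.Theory.
Local Open Scope ring_scope.

(* The notations of [mpoly] clash with those of MathComp-Analysis, so [mpoly]
   is imported only inside this module. *)
Module StablePolynomial.
Import complex mpoly.

Definition real_stable (R : rcfType) (n : nat) (f : {mpoly R[n]}) : Prop :=
  forall z : 'I_n -> R[i], (forall i, 0 < complex.Im (z i)) ->
    (map_mpoly (real_complex R) f).@[z] != 0.

Definition generating_polynomial (R : nzRingType) (n : nat)
    (m : n.-tuple bool -> R) : {mpoly R[n]} :=
  \sum_(I : n.-tuple bool) m I *: \prod_(i < n) 'X_i ^+ tnth I i.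

End StablePolynomial.
Export StablePolynomial.

From mathcomp Require Import all_classical all_reals all_analysis.
Local Open Scope classical_set_scope.

Definition strongly_rayleigh (R : realType) (n : nat)
    (mu : probability (n.-tuple bool) R) : Prop :=
  real_stable (generating_polynomial (fun I => fine (mu [set I]))).

Section sequences_of_random_variables.
Context d d' (T : measurableType d) (T' : measurableType d') (R : realType)
  (P : probability T R).

Definition prefix_vector (X : nat -> {RV P >-> T'}) (n : nat) :
    T -> n.-tuple T' :=
  fun x => [tuple X i x | i < n].

Lemma measurable_prefix_vector (X : nat -> {RV P >-> T'}) n :
  measurable_fun [set: T] (prefix_vector X n).
Proof.
apply/measurable_fun_tnthP => i.
rewrite (_ : _ \o _ = X i); first exact: measurable_funPT.
by apply/funext => x /=; rewrite tnth_mktuple.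
Qed.

HB.instance Definition _ (X : nat -> {RV P >-> T'}) n :=
  isMeasurableFun.Build _ _ _ _ (prefix_vector X n)
    (@measurable_prefix_vector X n).

Definition sigma_from (X : nat -> {RV P >-> T'}) (n : nat) : set_system T :=
  <<s \bigcup_(i in [set i | (n <= i)%N]) g_sigma_algebra_preimage (X i) >>.

Definition tail_sigma_field (X : nat -> {RV P >-> T'}) : set_system T :=
  \bigcap_n sigma_from X n.

End sequences_of_random_variables.

(* The sequence is indexed from 0; the case n = 0 holds trivially, the
   generating polynomial being the constant 1. *)
Definition strongly_rayleigh_sequence d (T : measurableType d) (R : realType)
    (P : probability T R) (X : nat -> {RV P >-> bool}) : Prop :=
  forall n, strongly_rayleigh (distribution P (prefix_vector X n)).

(* Main.v *)
Require Import Defs.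
From mathcomp Require Import all_boot all_order all_algebra.
From mathcomp Require complex mpoly.
From mathcomp Require Import ring lra zify.

(** Let [C] be the event that [X_0, ..., X_(k-1)] take prescribed values and
   let [C0], [C1] be [C] with in addition [X_k = 0], resp. [X_k = 1]. For a
   cylinder event [B] in the variables [X_j], [m <= j < N], the function
   [\sum_(m <= j < N) X_j - 1_B] is increasing, so negative association of
   the conditioned measure with [X_k] bounds [|P(B & C0) P(C1) - P(B & C1)
   P(C0)|] by [\sum_(m <= j < N) d_j], where [d_j = P(X_j = 1 & C0) P(C1) -
   P(X_j = 1 & C1) P(C0) >= 0]. The series of the [d_j], [j > k], is bounded
   by [P(C0) P(C1)], so its tails vanish and a tail event is independent of
   every [X_0, ..., X_(k-1)], hence of itself.

   Both facts come from the homogenization [F(z, y) = \sum_I a_I z^I y^(D -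
   |I|)], which is stable by Garding's homotopy argument: pairwise negative
   correlation of the [X_j], and of [X_j] with [K = D - \sum_j X_j], is the
   first order expansion of an inequality between imaginary parts at the
   point [(1, ..., 1)]. The Feder-Mihail induction then gives negative
   association; as the support need not be homogeneous, it is run
   simultaneously for the size-biased measure [K a], whose polynomial is
   [dF/dy]. *)

(** The weight [K = D - |I|] takes the place of homogeneity. For a homogeneous measure, the
    Feder-Mihail induction finds a coordinate correlated nonnegatively with [G] because the
    covariances of the [I_j] with [G] add up to 0. Here they add up to [- Cov(K, G)], so the
    induction needs [Cov(K, G) <= 0], that is, negative association with [K] in the role of a
    coordinate. Proving this requires the same fact for the biased measure, whose degree is [D - 1],
    and so the induction closes. Correlations are written without denominators, so that conditioning
    on null events is no exception. *)

Set Implicit Arguments.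
Unset Strict Implicit.
Unset Printing Implicit Defensive.

Import Order.TTheory GRing.Theory Num.Theory.
Local Open Scope ring_scope.

(** * Roots of univariate polynomials and half-planes *)

Section UnivariatePolynomials.
Variable C : numClosedFieldType.
Implicit Types (p q : {poly C}) (z u v x y : C).

Lemma Im_sum (I : Type) (r : seq I) (P : pred I) (F : I -> C) :
  'Im (\sum_(i <- r | P i) F i) = \sum_(i <- r | P i) 'Im (F i).
Proof. exact: raddf_sum. Qed.

Lemma Im_le_norm z : 'Im z <= `|z|.
Proof.
have h : 'Im z \is Num.real by apply: Creal_Im.
have [Im_le0|Im_gt0] := real_leP h (real0 C).
  by apply: le_trans Im_le0 _; rewrite normr_ge0.
rewrite -(ger0_norm (ltW Im_gt0)) -(@ler_pXn2r _ 2) ?nnegrE //.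
by rewrite (real_normK h) normC2_Re_Im lerDr real_exprn_even_ge0 ?Creal_Re.
Qed.

Lemma Im_gt0_le0 z : ~~ (0 < 'Im z) = ('Im z <= 0).
Proof. by rewrite -real_leNgt ?real0 ?Creal_Im. Qed.

(** Every linear factor of [p] has modulus at least [rho] at [z]. *)
Lemma norm_horner_ge_dist p z (rho : C) : 0 <= rho ->
  (forall r, root p r -> rho <= `|z - r|) ->
  `|lead_coef p| * rho ^+ (size p).-1 <= `|p.[z]|.
Proof.
move=> rho0 hroot; have [r hp] := closed_field_poly_normal p.
have [->|p0] := eqVneq p 0; first by rewrite lead_coef0 normr0 mul0r normr_ge0.
have c0 : lead_coef p != 0 by rewrite lead_coef_eq0.
have rootr s : s \in r -> rho <= `|z - s|.
  by move=> sr; apply: hroot; rewrite hp rootZ // root_prod_XsubC.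
have -> : (size p).-1 = size r by rewrite hp size_scale // size_prod_XsubC.
rewrite [in leRHS]hp hornerZ normrM ler_wpM2l // horner_prod normr_prod.
elim: r rootr {hp} => [|s r IHr] hr; first by rewrite big_nil.
rewrite big_cons exprS ler_pM ?exprn_ge0 //; last first.
  by apply: IHr => t tr; apply: hr; rewrite inE tr orbT.
by rewrite hornerXsubC hr // inE eqxx.
Qed.

(** The roots of [p] lie in the closed lower half-plane, hence at distance at least ['Im z] from
    [z]. *)
Lemma norm_horner_ge_Im p z : 0 <= 'Im z ->
  (forall w, 0 < 'Im w -> p.[w] != 0) ->
  `|lead_coef p| * 'Im z ^+ (size p).-1 <= `|p.[z]|.
Proof.
move=> z0 hp; apply: norm_horner_ge_dist => // r rr.
have r0 : 'Im r <= 0.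
  by rewrite -Im_gt0_le0; apply: contraL rr => /hp; rewrite rootE.
by apply: le_trans (Im_le_norm _); rewrite raddfB lerBrDr gerDl.
Qed.

(** Gauss-Lucas: the logarithmic derivative is the sum of the [(z - r)^-1] over the roots [r], and
    each term has negative imaginary part. *)
Lemma deriv_neq0_upper p : (1 < size p)%N ->
  (forall w, 0 < 'Im w -> p.[w] != 0) ->
  forall z, 0 < 'Im z -> p^`().[z] != 0.
Proof.
move=> sp hp z z0; have [r hpr] := closed_field_poly_normal p.
have c0 : lead_coef p != 0.
  by rewrite lead_coef_eq0 -size_poly_gt0 (ltn_trans _ sp).
have rr s : s \in r -> 'Im s <= 0.
  move=> sr; rewrite -Im_gt0_le0; apply/negP => /hp/negP; apply.
  by rewrite -/(root p s) hpr rootZ // root_prod_XsubC.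
have : r != [::].
  apply: contraTneq sp => r0; rewrite hpr r0 big_nil -leqNgt.
  by rewrite alg_polyC size_polyC leq_b1.
pose q s := \prod_(z <- s) ('X - z%:P) : {poly C}.
have qd s : {subset s <= r} -> (q s).[z] != 0 /\
   (q s)^`().[z] = (q s).[z] * \sum_(w <- s) (z - w)^-1.
  elim: s => [|w s IHs] hs.
    by rewrite /q !big_nil mulr0 hornerC oner_eq0 -polyC1 derivC hornerC.
  have [|qs0 qsE] := IHs; first by move=> t ts; apply: hs; rewrite inE ts orbT.
  have zw0 : z - w != 0.
    rewrite subr_eq0; apply: contraTneq z0 => ->.
    by rewrite Im_gt0_le0 rr // hs // inE eqxx.
  rewrite /q !big_cons derivM derivXsubC hornerD !hornerM hornerC hornerXsubC.
  rewrite -/(q s) mulf_neq0 //; split => //.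
  by rewrite qsE; field.
have [//|qr0 qrE] := qd r => r0.
rewrite hpr derivZ hornerZ mulf_neq0 // qrE mulf_neq0 //.
suff : 'Im (\sum_(w <- r) (z - w)^-1) < 0.
  by apply: contraTneq => ->; rewrite raddf0 ltxx.
rewrite Im_sum; case: r rr r0 {hpr qd qr0 qrE} => [//|s r] rr _.
have h t : t \in s :: r -> 'Im (z - t)^-1 < 0.
  move=> tr; rewrite ImV mulNr oppr_lt0 divr_gt0 //.
    by rewrite raddfB subr_gt0 (le_lt_trans (rr _ tr)).
  rewrite exprn_gt0 // normr_gt0 subr_eq0; apply: contraTneq z0 => ->.
  by rewrite Im_gt0_le0 rr.
rewrite big_cons -[ltRHS]addr0 ltr_leD ?h ?inE ?eqxx //.
rewrite big_seq sumr_le0 // => t tr; apply/ltW/h.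
by rewrite inE tr orbT.
Qed.

Definition coef_norm_sum p : C := \sum_(k < size p) `|p`_k|.

Lemma coef_norm_sum_ge0 p : 0 <= coef_norm_sum p.
Proof. by apply: sumr_ge0. Qed.

Lemma norm_horner_le p z : `|z| <= 1 -> `|p.[z]| <= coef_norm_sum p.
Proof.
move=> z1; rewrite horner_coef (le_trans (ler_norm_sum _ _ _)) //.
apply: ler_sum => k _; rewrite normrM ler_piMr // normrX exprn_ile1 //.
Qed.

Lemma poly_split1 p : exists q, p = p.[0]%:P + q * 'X.
Proof.
have /factor_theorem[q hq] : root (p - p.[0]%:P) 0.
  by rewrite rootE !hornerE subrr.
by exists q; rewrite -[p in LHS](subrK p.[0]%:P) addrC hq subr0.
Qed.

(** Passage to the limit as [e] tends to 0, made algebraic so that it holds over any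
    [numClosedFieldType]. *)
Lemma ge0_of_perturb x y : x \is Num.real -> 0 <= y ->
  (forall e, 0 < e -> e <= 1 -> 0 <= x + e * y) -> 0 <= x.
Proof.
move=> xr y0 h; rewrite real_leNgt ?real0 //; apply/negP => x0.
(* With this [e] the perturbed value is [- (x ^+ 2 / (y - x))], which is negative. *)
pose e := - x / (y - x).
have yx0 : 0 < y - x by rewrite subr_gt0 (lt_le_trans x0).
have e0 : 0 < e by rewrite divr_gt0 // oppr_gt0.
have e1 : e <= 1 by rewrite ler_pdivrMr // mul1r lerDr.
have := h _ e0 e1; rewrite /e.
rewrite (_ : x + _ = - (x ^+ 2 / (y - x))); last by field; rewrite gt_eqF.
rewrite oppr_ge0 lt_geF // divr_gt0 // real_exprn_even_gt0 //=.
by rewrite lt_eqF.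
Qed.

Lemma norm_horner0_ge p (kappa : C) : kappa \is Num.real ->
  (forall e, 0 < e -> kappa <= `|p.[e]|) -> kappa <= `|p.[0]|.
Proof.
move=> kr h; have [q hq] := poly_split1 p.
rewrite -subr_ge0; apply: (@ge0_of_perturb _ (coef_norm_sum q)).
- by rewrite realB // normr_real.
- exact: coef_norm_sum_ge0.
move=> e e0 e1; rewrite addrAC subr_ge0 (le_trans (h e e0)) //.
rewrite {1}hq !hornerE (le_trans (ler_normD _ _)) // lerD2l.
rewrite normrM (gtr0_norm e0) mulrC ler_wpM2l ?(ltW e0) //.
by rewrite norm_horner_le // gtr0_norm.
Qed.

(** Up to order [e ^+ 2], the imaginary part of [p.[e]] is [e] times that of the linear coefficient;
    divide by [e]. *)
Lemma Im_coef1_ge0 p : p.[0] \is Num.real ->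
  (forall e, 0 < e -> 0 <= 'Im p.[e]) -> 0 <= 'Im p^`().[0].
Proof.
move=> p0 h; have [q hq] := poly_split1 p; have [s hs] := poly_split1 q.
have -> : p^`().[0] = q.[0].
  by rewrite hq derivD derivC derivM derivX !hornerE.
apply: (@ge0_of_perturb _ (coef_norm_sum s)).
- exact: Creal_Im.
- exact: coef_norm_sum_ge0.
move=> e e0 e1; have er : e \is Num.real by rewrite gtr0_real.
have := h e e0; rewrite {1}hq !hornerE raddfD /= (Creal_ImP _ p0) add0r.
rewrite (ImMr er) pmulr_lge0 // => /le_trans; apply.
rewrite {1}hs !hornerE raddfD /= lerD2l (ImMr er) mulrC ler_wpM2l ?(ltW e0) //.
by rewrite (le_trans (Im_le_norm _)) // norm_horner_le // gtr0_norm.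
Qed.

Lemma norm_subXn_le z w (M : C) k : `|z| <= M -> `|w| <= M ->
  `|z ^+ k - w ^+ k| <= `|z - w| * (M ^+ k.-1 *+ k).
Proof.
move=> zM wM; rewrite subrXX normrM ler_wpM2l //.
rewrite (le_trans (ler_norm_sum _ _ _)) //.
rewrite -[X in _ *+ X]card_ord -sumr_const ler_sum // => i _.
have M0 : 0 <= M by apply: le_trans zM.
have -> : (M ^+ k.-1 = M ^+ (k.-1 - i) * M ^+ i).
  by rewrite -exprD subnK //; have := ltn_ord i; lia.
by rewrite normrM !normrX ler_pM ?exprn_ge0 // lerXn2r ?nnegrE.
Qed.

Lemma norm_horner_sub_le p z w (M : C) : `|z| <= M -> `|w| <= M ->
  `|p.[z] - p.[w]| <=
    `|z - w| * \sum_(k < size p) `|p`_k| * (M ^+ k.-1 *+ k).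
Proof.
move=> zM wM; rewrite !horner_coef -sumrB (le_trans (ler_norm_sum _ _ _)) //.
rewrite mulr_sumr ler_sum // => k _; rewrite -mulrBr normrM mulrCA.
by rewrite ler_wpM2l // norm_subXn_le.
Qed.

(* A family of polynomials of constant degree with no real root, uniformly,
   keeps all its roots in the lower half-plane: moving the parameter from [1]
   to [0] in small enough steps, a root in the upper half-plane stays at
   distance [rho] from the real axis and so cannot leave. *)
Section Homotopy.
Variables (G : {poly {poly C}}) (d : nat) (c : C).
Hypotheses (c_neq0 : c != 0) (size_G : (size G <= d.+1)%N)
  (lead_G : G`_d = c%:P).

Let slice s : {poly C} := map_poly (horner_eval s) G.

Let sliceE s u : (slice s).[u] = G.[u%:P].[s].
Proof.
by rewrite /slice -[u in LHS](hornerC u s) -[_.[s]]/(horner_eval s _)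
  horner_map.
Qed.

Let coef_slice s k : (slice s)`_k = (G`_k).[s].
Proof. by rewrite coef_map. Qed.

Let size_slice s : size (slice s) = d.+1.
Proof.
apply/eqP; rewrite eqn_leq (leq_trans (size_poly _ _)) //=.
by rewrite ltnNge; apply/negP => /leq_sizeP/(_ d (leqnn _));
  rewrite coef_slice lead_G hornerC; apply/eqP.
Qed.

Let lead_slice s : lead_coef (slice s) = c.
Proof. by rewrite lead_coefE size_slice coef_slice lead_G hornerC. Qed.

Let B : C := \sum_(k < d.+1) coef_norm_sum G`_k.

Let B_ge0 : 0 <= B.
Proof. by apply: sumr_ge0 => k _; apply: coef_norm_sum_ge0. Qed.

Let norm_coef_slice s k : `|s| <= 1 -> `|(slice s)`_k| <= coef_norm_sum G`_k.
Proof. by move=> s1; rewrite coef_slice norm_horner_le. Qed.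

Let M : C := 1 + B / `|c|.

(** Cauchy's root bound, uniform in [s] because the leading coefficient is constant. *)
Let root_slice_bound s u : `|s| <= 1 -> (slice s).[u] = 0 -> `|u| <= M.
Proof.
move=> s1 su0; have c0 : 0 < `|c| by rewrite normr_gt0.
have [u1|u1] := real_leP (normr_real u) (real1 C).
  by rewrite (le_trans u1) // lerDl divr_ge0.
rewrite -[leLHS]add0r lerD // ler_pdivlMr //.
move: su0; rewrite (horner_coef_wide _ (eq_leq (size_slice s))) big_ord_recr /=.
rewrite coef_slice lead_G hornerC => /eqP; rewrite addrC addr_eq0 => /eqP cE.
have : `|c| * `|u| ^+ d <= \sum_(k < d) coef_norm_sum G`_k * `|u| ^+ d.-1.
  rewrite -normrX -normrM cE normrN (le_trans (ler_norm_sum _ _ _)) //.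
  apply: ler_sum => k _; rewrite normrM ler_pM // ?norm_coef_slice // normrX.
  by rewrite ler_weXn2l ?(ltW u1) //; have := ltn_ord k; lia.
(* For [d = 0] the slice is the nonzero constant [c] and has no root. *)
rewrite /B; case: (d) cE => [|d'] cE.
  move: cE; rewrite big_ord0 oppr0 expr0 mulr1 => c00.
  by case/eqP: c_neq0.
rewrite -mulr_suml exprS mulrA ler_pM2r ?exprn_gt0 ?(lt_trans _ u1) //.
rewrite mulrC => /le_trans; apply.
by rewrite [leRHS]big_ord_recr /= lerDl coef_norm_sum_ge0.
Qed.

(** Lipschitz constants of [(slice s).[u]] in [u] and in [s], for [s] in the unit disc and [u] in
    the disc of radius [M]. The summand 1 makes [L1] positive, as division by it defines [rho]. *)
Let L1 : C := 1 + \sum_(k < d.+1) coef_norm_sum G`_k * (M ^+ k.-1 *+ k).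
Let L2 : C := \sum_(k < d.+1)
  (\sum_(l < size G`_k) `|G`_k`_l| * (1 ^+ l.-1 *+ l)) * M ^+ k.

Let M_ge0 : 0 <= M.
Proof. by rewrite addr_ge0 // divr_ge0. Qed.

Let L1_gt0 : 0 < L1.
Proof.
rewrite ltr_pwDl // sumr_ge0 // => k _.
by rewrite mulr_ge0 ?coef_norm_sum_ge0 // mulrn_wge0 ?exprn_ge0.
Qed.

Let L2_ge0 : 0 <= L2.
Proof.
apply: sumr_ge0 => k _; rewrite mulr_ge0 ?exprn_ge0 // sumr_ge0 // => l _.
by rewrite mulr_ge0 // mulrn_wge0 // exprn_ge0.
Qed.

Let slice_lip_u s u v : `|s| <= 1 -> `|u| <= M -> `|v| <= M ->
  `|(slice s).[u] - (slice s).[v]| <= `|u - v| * L1.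
Proof.
move=> s1 uM vM; rewrite (le_trans (norm_horner_sub_le _ uM vM)) //.
rewrite ler_wpM2l // size_slice ler_wpDl // ler_sum // => k _.
by rewrite ler_wpM2r ?norm_coef_slice // mulrn_wge0 ?exprn_ge0.
Qed.

Let slice_lip_s s t u : `|s| <= 1 -> `|t| <= 1 -> `|u| <= M ->
  `|(slice s).[u] - (slice t).[u]| <= `|s - t| * L2.
Proof.
move=> s1 t1 uM; rewrite !(horner_coef_wide _ (eq_leq (size_slice _))).
rewrite -sumrB (le_trans (ler_norm_sum _ _ _)) // mulr_sumr ler_sum // => k _.
rewrite -mulrBl normrM mulrA ler_pM //; last first.
  by rewrite normrX lerXn2r // nnegrE.
by rewrite !coef_slice norm_horner_sub_le.
Qed.

Hypothesis archi : Num.archimedean_axiom C.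
Variable kappa : C.
Hypotheses (kappa_gt0 : 0 < kappa)
  (real_lbound : forall s u, 0 <= s -> s <= 1 -> u \is Num.real ->
     kappa <= `|G.[u%:P].[s]|)
  (start : forall u, 0 <= 'Im u -> G.[u%:P].[0] != 0).

Let rho : C := kappa / L1.

Let rho_gt0 : 0 < rho.
Proof. exact: divr_gt0. Qed.

(** The slice vanishes at [u] but has modulus at least [kappa] at ['Re u], which is only ['Im u]
    away. *)
Let Im_root_ge s u : 0 <= s -> s <= 1 -> 0 <= 'Im u -> (slice s).[u] = 0 ->
  rho <= 'Im u.
Proof.
move=> s0 s1 u0 su0; rewrite ler_pdivrMr //.
have ns1 : `|s| <= 1 by rewrite ger0_norm.
have uM := root_slice_bound ns1 su0.
have rM : `|'Re u| <= M by rewrite (le_trans _ uM) // leif_normC_Re_Creal.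
rewrite (le_trans (real_lbound s0 s1 (Creal_Re u))) // -sliceE.
rewrite -[X in `|X|]subr0 -su0 (le_trans (slice_lip_u ns1 rM uM)) //.
rewrite ler_wpM2r ?(ltW L1_gt0) // {2}[u]Crect opprD addrA subrr add0r normrN.
by rewrite normrM normCi mul1r ger0_norm.
Qed.

(** If all roots of [slice t] were below the real axis, they would be at distance at least [rho]
    from [u], so [slice t] would be large at [u]; but it is close there to [slice s], which
    vanishes. *)
Let root_step s t u : 0 <= s -> s <= 1 -> 0 <= t -> t <= 1 ->
  `|t - s| * L2 < `|c| * rho ^+ d ->
  0 <= 'Im u -> (slice s).[u] = 0 -> exists2 v, 0 <= 'Im v & (slice t).[v] = 0.
Proof.
move=> s0 s1 t0 t1 st u0 su0; have hu := Im_root_ge s0 s1 u0 su0.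
have ns1 : `|s| <= 1 by rewrite ger0_norm.
have nt1 : `|t| <= 1 by rewrite ger0_norm.
have uM := root_slice_bound ns1 su0.
have /hasP [v _ /andP[vt0 v0]] : has (fun v => root (slice t) v && (0 <= 'Im v))
    (sval (closed_field_poly_normal (slice t))).
  apply/negPn/negP => /hasPn h.
  have : `|lead_coef (slice t)| * rho ^+ (size (slice t)).-1 <= `|(slice
    t).[u]|.
    apply: norm_horner_ge_dist => [|v vt]; first exact: ltW.
    have vin : v \in sval (closed_field_poly_normal (slice t)).
      move: vt; rewrite {1}(svalP (closed_field_poly_normal (slice t))).
      by rewrite rootZ ?lead_slice // root_prod_XsubC.
    have := h v vin; rewrite vt /= -real_ltNge ?Creal_Im ?real0 // => v0.
    apply: le_trans hu (le_trans _ (Im_le_norm _)).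
    by rewrite raddfB /= lerBrDr gerDl ltW.
  rewrite lead_slice size_slice /=; apply/negP; rewrite lt_geF //.
  rewrite -[X in `|X|]subr0 -su0; apply: le_lt_trans st.
  exact: slice_lip_s.
by exists v => //; apply/eqP.
Qed.

Lemma homotopy_root_free u : 0 <= 'Im u -> G.[u%:P].[1] != 0.
Proof.
move=> u0; apply/eqP => Gu0.
have eps_gt0 : 0 < `|c| * rho ^+ d by rewrite mulr_gt0 ?normr_gt0 ?exprn_gt0.
(* Steps of length [1/n] are short enough for [root_step]. They lead from 1 down to 0, where [start]
   forbids a root. *)
have [n] := archi (L2 / (`|c| * rho ^+ d)).
rewrite ger0_norm ?(divr_ge0 L2_ge0 (ltW eps_gt0)) // ltr_pdivrMr // => hn.
have n0 : (0 < n)%N.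
  by case: n hn => //; rewrite mul0r => /(le_lt_trans L2_ge0); rewrite ltxx.
have nC0 : 0 < n%:R :> C by rewrite ltr0n.
pose s k : C := (n - k)%:R / n%:R.
have s0 k : 0 <= s k by rewrite divr_ge0 // ler0n.
have s1 k : s k <= 1 by rewrite ler_pdivrMr // mul1r ler_nat leq_subr.
have bad k : (k <= n)%N -> exists2 v, 0 <= 'Im v & (slice (s k)).[v] = 0.
  elim: k => [_|k IHk kn].
    by exists u => //; rewrite sliceE /s subn0 divff // gt_eqF.
  have [v v0 kv0] := IHk (ltnW kn).
  apply: root_step (v0) (kv0) => //.
  rewrite (_ : s k.+1 - s k = - n%:R^-1); last first.
    rewrite /s -mulrBl -[(n - k)%N]prednK ?subn_gt0 // -subnS -[in X in _ -
      X]addn1 natrD.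
    by rewrite opprD addrA subrr add0r mulN1r.
  by rewrite normrN normfV gtr0_norm // mulrC ltr_pdivrMr // mulrC.
have [v v0] := bad n (leqnn n).
by apply/eqP; rewrite sliceE /s subnn mul0r start.
Qed.

End Homotopy.

End UnivariatePolynomials.

(** * Top coefficients under a degree bound *)

Section TopCoefficient.
Variable S : comNzRingType.
Implicit Types (p q : {poly S}) (c : S).

(** Unlike for [lead_coef], [c] may be 0, which makes the notion multiplicative over any commutative
    ring. *)
Definition top_coef (d : nat) c p := (size p <= d.+1)%N /\ p`_d = c.

Lemma top_coefM d e b c p q : top_coef d b p -> top_coef e c q ->
  top_coef (d + e) (b * c) (p * q).
Proof.
move=> [sp <-] [sq <-]; split.
  apply: leq_trans (size_polyMleq _ _) _; rewrite -subn1 leq_subLR.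
  by apply: leq_trans (leq_add sp sq) _; lia.
have hd : (d < (d + e).+1)%N by lia.
rewrite coefM (bigD1 (Ordinal hd)) //= addKn big1 ?addr0 // => i.
rewrite -val_eqE /= => id; have [i_lt|i_ge] := ltnP i d.
  by rewrite [q`_ _]nth_default ?mulr0 // (leq_trans sq) //; lia.
by rewrite nth_default ?mul0r // (leq_trans sp) //; lia.
Qed.

Lemma top_coefX d c p k : top_coef d c p -> top_coef (d * k) (c ^+ k) (p ^+ k).
Proof.
move=> hp; elim: k => [|k IHk].
  by rewrite muln0 !expr0; split; rewrite ?size_poly1 ?coef1.
by rewrite mulnS !exprS; apply: top_coefM.
Qed.

Lemma top_coef_prod (I : Type) (r : seq I) (d : I -> nat) (c : I -> S)
    (p : I -> {poly S}) : (forall i, top_coef (d i) (c i) (p i)) ->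
  top_coef (\sum_(i <- r) d i) (\prod_(i <- r) c i) (\prod_(i <- r) p i).
Proof.
move=> hp; elim: r => [|i r IHr].
  by rewrite !big_nil; split; rewrite ?size_poly1 ?coef1.
by rewrite !big_cons; apply: top_coefM.
Qed.

Lemma top_coef_sum (I : Type) (r : seq I) d (c : I -> S) (p : I -> {poly S}) :
  (forall i, top_coef d (c i) (p i)) ->
  top_coef d (\sum_(i <- r) c i) (\sum_(i <- r) p i).
Proof.
move=> hp; split; last by rewrite coef_sum; apply: eq_bigr => i _; case: (hp i).
apply: (big_ind (fun q : {poly S} => size q <= d.+1)%N) => [|p' q' hp' hq'|i _].
- by rewrite size_poly0.
- by rewrite (leq_trans (size_polyD _ _)) // geq_max hp'.
by case: (hp i).
Qed.

Lemma top_coef_linear (s t : S) : top_coef 1 t (s%:P + t%:P * 'X).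
Proof.
split; last by rewrite coefD coefC coefCM coefX mulr1 add0r.
apply/leq_sizeP => j hj; rewrite coefD coefC coefCM coefX.
by case: j hj => [|[|j]] //= _; rewrite mulr0 addr0.
Qed.

Lemma top_coef_linearX (s t : S) k :
  top_coef k (t ^+ k) ((s%:P + t%:P * 'X) ^+ k).
Proof. by rewrite -{1}[k]mul1n; apply/top_coefX/top_coef_linear. Qed.

End TopCoefficient.

(** * Stable homogeneous polynomials *)

Section HomogeneousPolynomial.
Variable n : nat.
Implicit Types I : n.-tuple bool.

Definition wt I : nat := \sum_i tnth I i.

(** An evaluation in an arbitrary ring: arguments in [{poly C}] give restrictions to lines,
    arguments in [{poly {poly C}}] two-parameter families. The truncated exponent [D - wt I] is the
    intended one under [supp_le]. *)
Definition hom_poly (S : comNzRingType) (D : nat) (a : n.-tuple bool -> S)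
    (z : 'I_n -> S) (y : S) : S :=
  \sum_I a I * (\prod_i z i ^+ tnth I i) * y ^+ (D - wt I).

Definition supp_le (S : comNzRingType) (D : nat) (a : n.-tuple bool -> S) :=
  forall I, a I != 0 -> (wt I <= D)%N.

Definition upd (S : Type) (z : 'I_n -> S) j w : 'I_n -> S :=
  fun k => if k == j then w else z k.

(** Conditioning without normalising or dropping the coordinate, so that slices iterate within one
    type. *)
Definition slice (S : nmodType) (j : 'I_n) (b : bool) (a : n.-tuple bool -> S) :
    n.-tuple bool -> S :=
  fun I => a I *+ (tnth I j == b).

(* Up to normalisation, the law of [I] biased by the exponent of the
   homogenizing variable [y]. *)
Definition bias (S : nmodType) (D : nat) (a : n.-tuple bool -> S) :
    n.-tuple bool -> S :=
  fun I => a I *+ (D - wt I).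

Lemma slice_ge0 (R : numDomainType) j b (a : n.-tuple bool -> R) :
  (forall I, 0 <= a I) -> forall I, 0 <= slice j b a I.
Proof. by move=> a0 I; rewrite mulrn_wge0. Qed.

Lemma bias_ge0 (R : numDomainType) D (a : n.-tuple bool -> R) :
  (forall I, 0 <= a I) -> forall I, 0 <= bias D a I.
Proof. by move=> a0 I; rewrite mulrn_wge0. Qed.

Lemma eq_hom_poly (S : comNzRingType) D (a a' : n.-tuple bool -> S) z z' y y' :
  a =1 a' -> z =1 z' -> y = y' -> hom_poly D a z y = hom_poly D a' z' y'.
Proof.
move=> ha hz ->; apply: eq_bigr => I _; rewrite ha.
by congr (_ * _ * _); apply: eq_bigr => i _; rewrite hz.
Qed.

Lemma rmorph_hom_poly (S S' : comNzRingType) (f : {rmorphism S -> S'}) D a z y :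
  f (hom_poly D a z y) = hom_poly D (f \o a) (f \o z) (f y).
Proof.
rewrite rmorph_sum; apply: eq_bigr => I _; rewrite !rmorphM /= rmorphXn.
by rewrite rmorph_prod; congr (_ * _ * _); apply: eq_bigr => i _;
  rewrite rmorphXn.
Qed.

Lemma hom_polyZ (S : comNzRingType) D (a : n.-tuple bool -> S) z y w :
  supp_le D a ->
  hom_poly D a (fun i => w * z i) (w * y) = w ^+ D * hom_poly D a z y.
Proof.
move=> ha; rewrite mulr_sumr; apply: eq_bigr => I _.
have [->|/ha aI] := eqVneq (a I) 0; first by rewrite !mul0r mulr0.
have -> : w ^+ D = (\prod_i w ^+ tnth I i) * w ^+ (D - wt I).
  by rewrite prodrXr -exprD subnKC.
rewrite (eq_bigr (fun i => w ^+ tnth I i * z i ^+ tnth I i)) => [|i _].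
  by rewrite big_split /= exprMn; ring.
by rewrite exprMn.
Qed.

(** The gain from homogeneity: the top coefficient along a line depends only on the direction, hence
    is constant on a family of parallel lines. *)
Lemma top_hom_poly (S : comNzRingType) D (a : n.-tuple bool -> S) s t y y' :
  supp_le D a ->
  top_coef D (hom_poly D a t y') (hom_poly D (polyC \o a)
    (fun i => (s i)%:P + (t i)%:P * 'X) (y%:P + y'%:P * 'X)).
Proof.
move=> ha; apply: top_coef_sum => I /=.
have [->|/ha aI] := eqVneq (a I) 0.
  by rewrite !mul0r; split; rewrite ?size_poly0 ?coef0.
rewrite -{1}(subnKC aI) -[(wt I)%N]add0n.
do 2?apply: top_coefM.
- by split; rewrite ?size_polyC_leq1 ?coefC.
- by apply: top_coef_prod => i; apply: top_coef_linearX.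
- exact: top_coef_linearX.
Qed.

(** The polynomial is affine in [z j]. Setting [z j] to 1 in the [true] slice strips that factor;
    the [false] slice does not see [z j]. *)
Lemma hom_poly_upd (S : comNzRingType) D (a : n.-tuple bool -> S) z y j w :
  hom_poly D a (upd z j w) y =
  hom_poly D (slice j false a) z y + w * hom_poly D (slice j true a) (upd z j
    1) y.
Proof.
rewrite mulr_sumr -big_split; apply: eq_bigr => I _ /=.
rewrite /slice (bigD1 j) //= [in X in _ = X + _](bigD1 j) //= [in X in _ = _ +
  X](bigD1 j) //=.
rewrite /upd eqxx.
have hE c : \prod_(i | i != j) (if i == j then c else z i) ^+ tnth I i =
    \prod_(i | i != j) z i ^+ tnth I i.
  by apply: eq_bigr => i /negPf ->.
by rewrite !hE; case: (tnth I j); rewrite /= ?mulr0n ?mulr1n; ring.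
Qed.

End HomogeneousPolynomial.

(** * Stability, conditioning and size biasing *)

Section Stability.
Variables (C : numClosedFieldType) (n : nat).
Implicit Types (I : n.-tuple bool) (a : n.-tuple bool -> C) (z : 'I_n -> C).
Implicit Types (y w : C) (D : nat).

(* The zero polynomial counts as stable, so that [stable] is closed under
   conditioning on events of probability zero. *)
Definition stable D a := [/\ forall I, 0 <= a I, supp_le D a &
  forall z y, (forall i, 0 < 'Im (z i)) -> 0 < 'Im y ->
    hom_poly D a z y = 0 -> forall I, a I = 0].

Lemma monomial_ge0 z y D I : (forall i, 0 <= z i) -> 0 <= y ->
  0 <= (\prod_i z i ^+ tnth I i) * y ^+ (D - wt I).
Proof. by move=> z0 y0; rewrite mulr_ge0 ?exprn_ge0 ?prodr_ge0 // => i _;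
  rewrite exprn_ge0. Qed.

Lemma hom_poly_ge0 D a z y : (forall I, 0 <= a I) -> (forall i, 0 <= z i) ->
  0 <= y -> 0 <= hom_poly D a z y.
Proof.
by move=> a0 z0 y0; apply: sumr_ge0 => I _; rewrite -mulrA mulr_ge0 //
  monomial_ge0.
Qed.

Lemma hom_poly_ge D a z y I : (forall I, 0 <= a I) -> (forall i, 0 <= z i) ->
  0 <= y -> a I * (\prod_i z i ^+ tnth I i) * y ^+ (D - wt I) <= hom_poly D a z
    y.
Proof.
move=> a0 z0 y0; rewrite /hom_poly (bigD1 I) //= lerDl sumr_ge0 // => J _.
by rewrite -mulrA mulr_ge0 // monomial_ge0.
Qed.

Lemma hom_poly_gt0 D a z y I : (forall I, 0 <= a I) -> (forall i, 0 < z i) ->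
  0 < y -> a I != 0 -> 0 < hom_poly D a z y.
Proof.
move=> a0 z0 y0 aI; have z0' i : 0 <= z i by apply: ltW.
apply: lt_le_trans (hom_poly_ge D I a0 z0' (ltW y0)).
have aI_gt0 : 0 < a I by rewrite lt0r aI a0.
by rewrite !mulr_gt0 ?exprn_gt0 ?prodr_gt0 //= => i _; rewrite exprn_gt0.
Qed.

Lemma hom_poly_conj D a z y : (forall I, 0 <= a I) ->
  hom_poly D a (fun i => (z i)^*) y^* = (hom_poly D a z y)^*.
Proof.
move=> a0; rewrite [RHS]rmorph_hom_poly; apply: eq_hom_poly => // I.
by rewrite /= conj_Creal // ger0_real.
Qed.

Lemma horner_hom_poly D a (p : 'I_n -> {poly C}) q x :
  (hom_poly D (polyC \o a) p q).[x] = hom_poly D a (fun i => (p i).[x]) q.[x].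
Proof.
rewrite -[LHS]/(horner_eval x _) rmorph_hom_poly.
by apply: eq_hom_poly => // I /=; rewrite /horner_eval hornerC.
Qed.

Lemma Im_rect_real (x y : C) t : x \is Num.real -> y \is Num.real ->
  'Im (x + y * t) = y * 'Im t.
Proof. by move=> xr yr; rewrite raddfD /= (Creal_ImP _ xr) add0r ImMl. Qed.

(* Restrict to the line [x + t y]: a real-rooted polynomial in [t] with
   leading coefficient [F(y)], evaluated at [t = 'i]. Unlike non-vanishing,
   the bound passes to limits. *)
Lemma stable_lbound D a z y : stable D a ->
  (forall i, 0 < 'Im (z i)) -> 0 < 'Im y ->
  hom_poly D a (fun i => 'Im (z i)) ('Im y) <= `|hom_poly D a z y|.
Proof.
move=> [a0 aD a_st] z0 y0.
have [c0|c_neq0] := eqVneq (hom_poly D a (fun i => 'Im (z i)) ('Im y)) 0.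
  by rewrite c0 normr_ge0.
have c_ge0 : 0 <= hom_poly D a (fun i => 'Im (z i)) ('Im y).
  by apply: hom_poly_ge0 => // [i|]; apply: ltW.
have [sp lp] := top_hom_poly (fun i => 'Re (z i)) (fun i =>
  'Im (z i)) ('Re y) ('Im y) aD.
set p := hom_poly _ _ _ _ in sp lp.
have size_p : size p = D.+1.
  apply/eqP; rewrite eqn_leq sp ltnNge; apply: contra c_neq0.
  by move=> /leq_sizeP /(_ _ (leqnn _)) <-; rewrite lp.
have pE t : p.[t] = hom_poly D a (fun i => 'Re (z i) + 'Im (z i) * t) ('Re y +
  'Im y * t).
  by rewrite horner_hom_poly !hornerE; apply: eq_hom_poly => // i;
    rewrite !hornerE.
have /norm_horner_ge_Im : 0 <= 'Im ('i : C) by rewrite Im_i.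
move=> /(_ p); rewrite lead_coefE size_p /= lp Im_i expr1n mulr1 ger0_norm //
  pE.
have -> : hom_poly D a (fun i => 'Re (z i) + 'Im (z i) * 'i) ('Re y + 'Im y *
  'i) = hom_poly D a z y.
  by apply: eq_hom_poly => [//|i|]; rewrite [RHS]Crect [_ * 'i]mulrC.
apply=> w w0; rewrite pE; apply: contra c_neq0 => /eqP /a_st aE.
rewrite /hom_poly big1 // => I _; rewrite aE ?mul0r // => [i|].
  by rewrite Im_rect_real ?Creal_Re ?Creal_Im // mulr_gt0.
by rewrite Im_rect_real ?Creal_Re ?Creal_Im // mulr_gt0.
Qed.

Lemma Im_upd z j w i : (forall i, 0 < 'Im (z i)) -> 0 < 'Im w ->
  0 < 'Im (upd z j w i).
Proof. by rewrite /upd; case: (i == j). Qed.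

Lemma slice_supp j b D a : supp_le D a -> supp_le D (slice j b a).
Proof.
by move=> aD I; rewrite /slice; case: (tnth I j == b);
  [apply: aD | rewrite eqxx].
Qed.

Lemma hom_poly_slice_upd0 D a j z y w :
  hom_poly D (slice j false a) (upd z j w) y = hom_poly D (slice j false a) z y.
Proof.
apply: eq_bigr => I _; rewrite /slice; case: eqP => [Ij|_];
  last by rewrite !mulr0n !mul0r.
rewrite !mulr1n; congr (_ * _ * _); apply: eq_bigr => i _; rewrite /upd.
by case: eqP => // ->; rewrite Ij !expr0.
Qed.

Lemma hom_poly_slice_upd1 D a j z y :
  hom_poly D (slice j true a) z y = z j * hom_poly D (slice j true a) (upd z j
    1) y.
Proof.
rewrite mulr_sumr; apply: eq_bigr => I _; rewrite /slice; case: eqP => [Ij|_];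
  last first.
  by rewrite !mulr0n !mul0r mulr0.
rewrite (bigD1 j) // [in RHS](bigD1 j) //= /upd eqxx Ij expr1n expr1 mul1r.
rewrite [in RHS](eq_bigr (fun i => z i ^+ tnth I i)) => [|i /negPf -> //].
by rewrite !mulr1n; ring.
Qed.

(** Put ['i * w] for [z j] in [stable_lbound]. Both sides are affine in [w], so small and large [w]
    isolate the two slices. *)
Lemma stable_slice_lbound D a z y j w : stable D a ->
  (forall i, 0 < 'Im (z i)) -> 0 < 'Im y -> 0 < w ->
  hom_poly D (slice j false a) (fun i => 'Im (z i)) ('Im y) +
    w * hom_poly D (slice j true a) (upd (fun i => 'Im (z i)) j 1) ('Im y) <=
  `|hom_poly D (slice j false a) z y| +
    w * `|hom_poly D (slice j true a) (upd z j 1) y|.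
Proof.
move=> a_st z0 y0 w0.
have Imw : 'Im ('i * w) = w by rewrite ImMil; apply/Creal_ReP;
  rewrite gtr0_real.
have : forall i, 0 < 'Im (upd z j ('i * w) i) by move=> i; apply: Im_upd => //;
  rewrite Imw.
move/(stable_lbound a_st)/(_ y0); rewrite hom_poly_upd => le1.
have {le1} := le_trans le1 (ler_normD _ _).
rewrite !normrM normCi mul1r (gtr0_norm w0) -hom_poly_upd.
apply: le_trans; rewrite le_eqVlt; apply/orP; left; apply/eqP.
by apply: eq_hom_poly => // i; rewrite /upd; case: eqP.
Qed.

(** At a zero of the slice, letting [w] tend to 0 (for [false]) or to infinity (for [true]) in
    [stable_slice_lbound] forces a positive quantity to be at most 0. *)
Lemma stable_slice j b D a : stable D a -> stable D (slice j b a).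
Proof.
move=> a_st; have [a0 aD _] := a_st; split; [exact: slice_ge0|exact:
  slice_supp|].
move=> z y z0 y0 hzy I; apply/eqP/negPn/negP => aI.
have le1 w : 0 < w -> _ := stable_slice_lbound j a_st z0 y0.
have a0' b' := slice_ge0 j b' a0.
case: b hzy aI => hzy aI; last first.
  have c_gt0 := hom_poly_gt0 D (a0' false) z0 y0 aI.
  set c := hom_poly _ _ _ _ in c_gt0.
  set c1 := `|hom_poly D (slice j true a) (upd z j 1) y|.
  have : 0 <= - c; last by rewrite oppr_ge0 lt_geF.
  apply: (@ge0_of_perturb _ _ c1); first by rewrite realN gtr0_real.
    exact: normr_ge0.
  move=> e e0 _.
  rewrite addrC subr_ge0; have := le1 e e0; rewrite hzy normr0 add0r -/c -/c1.
  apply: le_trans; rewrite lerDl mulr_ge0 ?(ltW e0) // hom_poly_ge0 //.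
    by move=> i; rewrite /upd; case: eqP => // _; apply: ltW.
  exact: ltW.
have hb : hom_poly D (slice j true a) (upd z j 1) y = 0.
  move/eqP: hzy; rewrite hom_poly_slice_upd1 mulf_eq0 => /orP[/eqP zj0|/eqP //].
  by have := z0 j; rewrite zj0 raddf0 ltxx.
have c_gt0 : 0 < hom_poly D (slice j true a) (upd (fun i =>
  'Im (z i)) j 1) ('Im y).
  by apply: hom_poly_gt0 aI => // i; rewrite /upd; case: eqP.
set c := hom_poly _ _ _ _ in c_gt0.
set c1 := `|hom_poly D (slice j false a) z y|.
have : 0 <= - c; last by rewrite oppr_ge0 lt_geF.
apply: (@ge0_of_perturb _ _ c1); first by rewrite realN gtr0_real.
  exact: normr_ge0.
move=> e e0 _.
rewrite addrC subr_ge0; have ei0 : 0 < e^-1 by rewrite invr_gt0.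
rewrite mulrC -ler_pdivrMr //; have := le1 _ ei0;
  rewrite hb normr0 mulr0 addr0 -/c -/c1.
rewrite [c / e]mulrC; apply: le_trans; rewrite lerDr hom_poly_ge0 //;
  last exact: ltW.
by move=> i; apply: ltW.
Qed.

Lemma hom_poly_bias D a z x :
  hom_poly D.-1 (bias D a) z x = (hom_poly D (polyC \o a) (polyC \o z)
    'X)^`().[x].
Proof.
rewrite /hom_poly linear_sum horner_sum; apply: eq_bigr => I _ /=.
have -> : \prod_i (z i)%:P ^+ tnth I i = (\prod_i z i ^+ tnth I i)%:P.
  by rewrite rmorph_prod; apply: eq_bigr => i _; rewrite rmorphXn.
rewrite -polyCM mul_polyC derivZ derivXn hornerZ hornerMn hornerXn /bias.
rewrite mulrnAl mulrnAl -mulrnAr; congr (_ * (_ ^+ _ *+ _)); lia.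
Qed.

(** Gauss-Lucas in [y]. The case of a polynomial constant in [y] is excluded by [stable_lbound] on
    the imaginary axis: a monomial with [wt I < D] forces at least linear growth. *)
Lemma stable_bias D a : stable D a -> stable D.-1 (bias D a).
Proof.
move=> a_st; have [a0 aD a_nz] := a_st; split; first exact: bias_ge0.
  move=> I; rewrite /bias -mulr_natr mulf_eq0 pnatr_eq0 negb_or => /andP[_].
  by lia.
move=> z y z0 y0; rewrite hom_poly_bias //.
set p := hom_poly _ _ _ _ => py0 I; apply/eqP/negPn/negP => bI.
have [aI dI] : a I != 0 /\ (0 < D - wt I)%N.
  by move: bI; rewrite /bias -mulr_natr mulf_eq0 pnatr_eq0 negb_or -lt0n =>
    /andP[].
have pE x : p.[x] = hom_poly D a z x.
  by rewrite horner_hom_poly hornerX; apply: eq_hom_poly => // i;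
    rewrite /= hornerC.
have hp x : 0 < 'Im x -> p.[x] != 0.
  by move=> x0; rewrite pE; apply: contra aI => /eqP /(a_nz _ _ z0 x0) ->.
have [sp|sp] := leqP (size p) 1; last first.
  by move/eqP: py0; apply/negP; apply: deriv_neq0_upper.
have [c pc] : exists c, p = c%:P by exists p`_0; apply: size1_polyC.
pose m := a I * \prod_i 'Im (z i) ^+ tnth I i.
have m0 : 0 < m.
  rewrite mulr_gt0 ?prodr_gt0 // => [|i _]; last by rewrite exprn_gt0.
  by rewrite lt0r aI a0.
have le1 x : 1 <= x -> m * x <= `|c|.
  move=> x1; have x0 : 0 < x by apply: lt_le_trans x1.
  have Imx : 'Im ('i * x) = x by rewrite ImMil; apply/Creal_ReP;
    rewrite gtr0_real.
  have := stable_lbound a_st z0 (y := 'i * x); rewrite Imx => /(_ x0).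
  rewrite -pE pc hornerC; apply: le_trans.
  apply: le_trans (hom_poly_ge D I a0 _ (ltW x0)); last by move=> i; apply: ltW.
  by rewrite -/m ler_pM2l // -[X in X <= _]expr1 ler_weXn2l.
(* At this point the lower bound is [m] plus the modulus of [c]. *)
have := le1 (1 + `|c| / m); rewrite lerDl divr_ge0 ?(ltW m0) // => /(_ isT).
by rewrite mulrDr mulr1 mulrCA divff ?gt_eqF // mulr1 gerDr lt_geF.
Qed.

End Stability.

(* [I0] witnesses that [D] is the degree of the dehomogenized polynomial:
   with a larger [D], [F z 0] would vanish and the lower bound [lbound_real]
   on real values of [y], which keeps the homotopy away from real roots,
   would be void. *)
Section Homogenization.
Variables (C : numClosedFieldType) (n D : nat) (a : n.-tuple bool -> C).
Variable I0 : n.-tuple bool.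
Hypotheses (a_ge0 : forall I, 0 <= a I) (a_supp : supp_le D a).
Hypotheses (aI0 : a I0 != 0) (wtI0 : wt I0 = D).
Hypothesis a_stable : forall z : 'I_n -> C,
  (forall i, 0 < 'Im (z i)) -> hom_poly D a z 1 != 0.

Let F := hom_poly D a.

Let dehom (z : 'I_n -> C) v : v != 0 -> F z v = v ^+ D * F (fun i =>
  v^-1 * z i) 1.
Proof.
move=> v0; rewrite /F -hom_polyZ // mulr1; apply: eq_hom_poly => // i.
by rewrite mulrA divff // mul1r.
Qed.

(** Dividing by a negative [v] moves [z] to the lower half-plane; as the coefficients are real,
    conjugation brings it back. *)
Let hom_poly_real_neq0 (z : 'I_n -> C) v : (forall i, 0 < 'Im (z i)) ->
  v \is Num.real -> v != 0 -> F z v != 0.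
Proof.
move=> z0 vr v0; have vVr : v^-1 \is Num.real by rewrite realV.
have [v_lt0|v_gt0|v00] := real_ltgtP vr (real0 C);
  last by rewrite v00 eqxx in v0.
  rewrite -conjC_eq0 -hom_poly_conj // (conj_Creal vr) -/F dehom //.
  rewrite mulf_neq0 ?expf_neq0 // a_stable // => i.
  by rewrite ImMl // Im_conj mulrN -mulNr mulr_gt0 // oppr_gt0 invr_lt0.
rewrite dehom // mulf_neq0 ?expf_neq0 // a_stable // => i.
by rewrite ImMl // mulr_gt0 // invr_gt0.
Qed.

Let top_gt0 (y : 'I_n -> C) : (forall i, 0 < y i) -> 0 < F y 0.
Proof.
move=> y0; have y0' i : 0 <= y i by apply: ltW.
apply: lt_le_trans (hom_poly_ge D I0 a_ge0 y0' (lexx 0)).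
have aI0_gt0 : 0 < a I0 by rewrite lt0r aI0 a_ge0.
rewrite wtI0 subnn expr0 mulr1 mulr_gt0 // prodr_gt0 // => i _.
exact: exprn_gt0.
Qed.

(** The line through the point has direction [('Im z, 0)], so the last argument stays equal to [v]
    and [hom_poly_real_neq0] excludes roots in the upper half-plane. *)
Let lbound_real_neq0 (z : 'I_n -> C) v : (forall i, 0 < 'Im (z i)) ->
  v \is Num.real -> v != 0 -> F (fun i => 'Im (z i)) 0 <= `|F z v|.
Proof.
move=> z0 vr v0; have c_gt0 : 0 < F (fun i => 'Im (z i)) 0 by apply: top_gt0.
have [sp lp] := top_hom_poly (fun i => 'Re (z i)) (fun i =>
  'Im (z i)) v 0 a_supp.
set p := hom_poly _ _ _ _ in sp lp.
have size_p : size p = D.+1.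
  apply/eqP; rewrite eqn_leq sp ltnNge; apply/negP.
  by move=> /leq_sizeP /(_ _ (leqnn _)); rewrite lp; apply/eqP; rewrite gt_eqF.
have pE t : p.[t] = F (fun i => 'Re (z i) + 'Im (z i) * t) v.
  rewrite horner_hom_poly; apply: eq_hom_poly => // [i|].
    by rewrite !hornerE.
  by rewrite !hornerE ?mul0r ?addr0.
have /norm_horner_ge_Im : 0 <= 'Im ('i : C) by rewrite Im_i.
move=> /(_ p); rewrite lead_coefE size_p /= lp Im_i expr1n mulr1 gtr0_norm //
  pE.
have -> : F (fun i => 'Re (z i) + 'Im (z i) * 'i) v = F z v.
  by apply: eq_hom_poly => [//|i|//]; rewrite [RHS]Crect [_ * 'i]mulrC.
apply=> w w0; rewrite pE hom_poly_real_neq0 // => i.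
by rewrite Im_rect_real ?Creal_Re ?Creal_Im // mulr_gt0.
Qed.

Let lbound_real (z : 'I_n -> C) v : (forall i, 0 < 'Im (z i)) ->
  v \is Num.real -> F (fun i => 'Im (z i)) 0 <= `|F z v|.
Proof.
move=> z0 vr; have [->|v0] := eqVneq v 0; last exact: lbound_real_neq0.
pose q := hom_poly D (polyC \o a) (polyC \o z) 'X.
have qE x : q.[x] = F z x.
  by rewrite horner_hom_poly hornerX; apply: eq_hom_poly => // i;
    rewrite /= hornerC.
rewrite -qE; apply: norm_horner0_ge; first by rewrite gtr0_real ?top_gt0.
by move=> e e0; rewrite qE lbound_real_neq0 ?gt_eqF ?gtr0_real.
Qed.

Let real_pos_neq0 (z : 'I_n -> C) v : (forall i,
  0 < z i) -> 0 < v -> F z v != 0.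
Proof. by move=> z0 v0; rewrite gt_eqF // (hom_poly_gt0 D a_ge0 z0 v0 aI0). Qed.

(** The start of the homotopy. For nonzero [u], dehomogenizing gives the point [w * y] with [y]
    positive, and only the sign of ['Im w] matters. If [w] is real, then [u] is a positive multiple
    of ['i], [w] is positive, and so is the polynomial. *)
Let ray_neq0 (y : 'I_n -> C) b u : (forall i, 0 < y i) -> 0 < b -> 0 <= 'Im u ->
  F (fun i => ('i + u) * y i) (b * u) != 0.
Proof.
move=> y0 b0 u0; have yr i : y i \is Num.real by rewrite gtr0_real.
have [->|u_neq0] := eqVneq u 0.
  rewrite mulr0 addr0 -normr_gt0; apply: lt_le_trans (lbound_real _ (real0 C)).
    by apply: top_gt0 => i; rewrite ImMr // Im_i mul1r.
  by move=> i; rewrite ImMr // Im_i mul1r.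
have bu_neq0 : b * u != 0 by rewrite mulf_neq0 // gt_eqF.
rewrite dehom // mulf_neq0 ?expf_neq0 //.
pose w := ('i + u) / (b * u).
have -> : F (fun i => (b * u)^-1 * (('i + u) * y i)) 1 = F (fun i => w * y i) 1.
  by apply: eq_hom_poly => // i; rewrite /w mulrA [_^-1 * _]mulrC.
have wE : w = b^-1 * (1 + 'i / u).
  by rewrite /w; field; rewrite u_neq0 gt_eqF.
have br : b^-1 \is Num.real by rewrite realV gtr0_real.
have bV0 : 0 < b^-1 by rewrite invr_gt0.
have Imw : 'Im w = b^-1 * 'Re (u^-1).
  by rewrite wE ImMl // raddfD /= (Creal_ImP _ (real1 C)) add0r ImMil.
have Imr : 'Im w \is Num.real by apply: Creal_Im.
have [w_lt0|w_gt0|w_eq0] := real_ltgtP Imr (real0 C).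
- rewrite -conjC_eq0 -hom_poly_conj // rmorph1 a_stable // => i.
  by rewrite Im_conj ImMr // oppr_gt0 pmulr_llt0.
- by rewrite a_stable // => i; rewrite ImMr // pmulr_lgt0.
have : 'Re u^-1 = 0.
  by move: w_eq0; rewrite Imw => /eqP; rewrite mulf_eq0 gt_eqF //= => /eqP.
rewrite ReV => /eqP; rewrite mulf_eq0 invr_eq0 expf_eq0 /= normr_eq0 (negPf
  u_neq0) orbF.
move=> /eqP Reu; have uE : u = 'i * 'Im u by rewrite {1}[u]Crect Reu add0r.
have Imu : 0 < 'Im u.
  by rewrite lt0r u0 andbT; apply: contra u_neq0 => /eqP h; rewrite uE h mulr0.
apply: real_pos_neq0 => // i; rewrite mulr_gt0 // wE mulr_gt0 // addr_gt0 //.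
by rewrite uE invfM mulrA divff ?neq0Ci // mul1r invr_gt0.
Qed.

Hypothesis archi : Num.archimedean_axiom C.

Lemma stable_homogenization : stable D a.
Proof.
split=> // z v z0 v0 zv0; have /negP[] : F z v != 0; last exact/eqP.
(* Half of ['Im (z i)] goes into a constant term that keeps the argument in the upper half-plane for
   real [u]; the other half is restored at [u = 'i]. *)
pose x i := 'Re (z i); pose y i := 'Im (z i) / 2.
have y0 i : 0 < y i by rewrite divr_gt0.
have yr i : y i \is Num.real by rewrite gtr0_real.
have xr i : x i \is Num.real by apply: Creal_Re.
have br : 'Re v \is Num.real by apply: Creal_Re.
(* The inner variable [s] scales the real parts. The last argument has no constant imaginary term,
   so it is real for real [u] and [lbound_real] applies. *)
pose G : {poly {poly C}} := hom_poly D (polyC \o (polyC \o a))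
  (fun i => (x i *: 'X + ('i * y i)%:P)%:P + ((y i)%:P)%:P * 'X)
  (('Re v *: 'X)%:P + ('Im v)%:P%:P * 'X).
have a_supp' : supp_le D (polyC \o a).
  by move=> I /=; rewrite polyC_eq0; apply: a_supp.
have [sG lG] := top_hom_poly (fun i => x i *: 'X + ('i * y i)%:P)
  (fun i => (y i)%:P) ('Re v *: 'X) ('Im v)%:P a_supp'.
have {}lG : G`_D = (F y ('Im v))%:P by rewrite lG rmorph_hom_poly.
have GE u s : G.[u%:P].[s] =
    F (fun i => (x i * s + 'i * y i) + y i * u) ('Re v * s + 'Im v * u).
  have -> : G.[u%:P].[s] = (horner_eval s \o horner_eval u%:P) G by [].
  rewrite rmorph_hom_poly; apply: eq_hom_poly => [I|i|] /=;
    by rewrite /horner_eval !hornerE.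
have c0 : F y ('Im v) != 0 by apply: real_pos_neq0.
have -> : F z v = G.['i%:P].[1].
  rewrite GE; apply: eq_hom_poly => [//|i|].
    rewrite mulr1 [_ * 'i]mulrC -addrA -mulrDr -splitr -/(x i).
    exact: Crect.
  by rewrite mulr1 [_ * 'i]mulrC -Crect.
have Im_arg s u i : s \is Num.real -> 'Im (x i * s + 'i * y i + y i * u) = y i
  * (1 + 'Im u).
  move=> sr; rewrite !raddfD /= (Creal_ImP _ (realM (xr i) sr)) add0r.
  by rewrite (ImMr (yr i)) Im_i (ImMl (yr i)) mul1r mulrDr mulr1.
have top_y : 0 < F y 0 by apply: top_gt0.
apply: (homotopy_root_free c0 sG lG archi top_y) => [s u s0 s1 ur|u u0|].
- have sr : s \is Num.real by rewrite ger0_real.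
  have Imu : 'Im u = 0 by apply/Creal_ImP.
  have argE i : y i = 'Im (x i * s + 'i * y i + y i * u).
    by rewrite Im_arg // Imu addr0 mulr1.
  have -> : F y 0 = F (fun i => 'Im (x i * s + 'i * y i + y i * u)) 0.
    exact: eq_hom_poly.
  rewrite GE lbound_real // => [i|].
    by rewrite -argE.
  by rewrite realD // realM // Creal_Im.
- have -> : G.[u%:P].[0] = F (fun i => ('i + u) * y i) ('Im v * u).
    rewrite GE; apply: eq_hom_poly => [//|i|]; last by rewrite mulr0 add0r.
    by rewrite mulr0 add0r mulrDl [u * _]mulrC.
  exact: ray_neq0.
by rewrite Im_i ler01.
Qed.

End Homogenization.

Section FirstOrder.
Variables (S : comNzRingType).
Implicit Types (p q : {poly S}) (c : S).

(** The value 1 makes [c] a logarithmic derivative, hence additive under products. *)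
Definition one_jet c p := p.[0] = 1 /\ p^`().[0] = c.

Lemma one_jetM b c p q : one_jet b p -> one_jet c q -> one_jet (b + c) (p * q).
Proof.
by move=> [p0 <-] [q0 <-]; split; rewrite ?derivM ?hornerD !hornerM p0 q0
  ?mulr1 ?mul1r.
Qed.

Lemma one_jet1 : one_jet 0 1.
Proof. by split; rewrite -?polyC1 ?derivC hornerC. Qed.

Lemma one_jetX c p k : one_jet c p -> one_jet (c *+ k) (p ^+ k).
Proof.
move=> hp; elim: k => [|k IHk]; first exact: one_jet1.
by rewrite exprS mulrS; apply: one_jetM.
Qed.

Lemma one_jet_prod (I : Type) (r : seq I) (c : I -> S) (p : I -> {poly S}) :
  (forall i, one_jet (c i) (p i)) ->
  one_jet (\sum_(i <- r) c i) (\prod_(i <- r) p i).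
Proof.
move=> hp; elim: r => [|i r IHr]; first by rewrite !big_nil; apply: one_jet1.
by rewrite !big_cons; apply: one_jetM.
Qed.

Lemma one_jet_linear c : one_jet c (1 + c%:P * 'X).
Proof.
rewrite -polyC1; split; first by rewrite !hornerE ?mulr0 ?addr0.
by rewrite derivD derivM !derivC derivX !hornerE ?mulr0 ?mulr1 ?addr0 ?add0r.
Qed.

End FirstOrder.

(** * Pairwise negative correlation *)

Section NegativeCorrelation.
Variables (C : numClosedFieldType) (n : nat).
Implicit Types (I : n.-tuple bool) (a : n.-tuple bool -> C) (z v : 'I_n -> C).
Implicit Types (y : C) (D : nat).

(** Logarithmic derivative of the monomial of [I] at [(1, ..., 1)] in the direction [(v, y)].
    Coordinate directions give the [I_i], the direction [(0, 1)] gives [K]. *)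
Definition dir_wt D v y I : C := (\sum_i v i *+ tnth I i) + y *+ (D - wt I).

Lemma jet_hom_poly D a v y (p := hom_poly D (polyC \o a)
    (fun i => 1 + (v i)%:P * 'X) (1 + y%:P * 'X)) :
  p.[0] = \sum_I a I /\ p^`().[0] = \sum_I a I * dir_wt D v y I.
Proof.
have jet I : one_jet (dir_wt D v y I)
    ((\prod_i (1 + (v i)%:P * 'X) ^+ tnth I i) * (1 + y%:P * 'X) ^+ (D - wt I)).
  apply: one_jetM; first by apply: one_jet_prod => i;
    apply/one_jetX/one_jet_linear.
  exact/one_jetX/one_jet_linear.
split.
  rewrite horner_sum; apply: eq_bigr => I _ /=.
  by rewrite -mulrA hornerCM (proj1 (jet I)) mulr1.
rewrite linear_sum horner_sum; apply: eq_bigr => I _ /=.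
by rewrite -mulrA derivM derivC mul0r add0r hornerCM (proj2 (jet I)).
Qed.

(** As a function of [z j] the polynomial is [A + z j * B]; a negative sign would put its root
    [- A / B] in the upper half-plane. *)
Lemma Im_slices_ge0 D a z y j : stable D a ->
  (forall i, 0 < 'Im (z i)) -> 0 < 'Im y ->
  0 <= 'Im (hom_poly D (slice j false a) z y *
            (hom_poly D (slice j true a) (upd z j 1) y)^*).
Proof.
move=> [a0 aD a_nz] z0 y0; set A := hom_poly _ _ _ _; set B := hom_poly _ _ _ _.
have h : 'Im (A * B^*) \is Num.real by apply: Creal_Im.
have [//|AB_lt0] := real_leP (real0 C) h.
have B_neq0 : B != 0.
  by apply: contraTneq AB_lt0 => ->; rewrite rmorph0 mulr0 raddf0 ltxx.
have nB0 : 0 < `|B| ^+ 2 by rewrite exprn_gt0 // normr_gt0.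
have wE : - A / B = - (A * B^*) / `|B| ^+ 2.
  by rewrite normCK -[- (A * _)]mulNr -mulf_div divff ?conjC_eq0 // mulr1.

have w0 : 0 < 'Im (- A / B).
  rewrite wE ImMr; last by rewrite realV realX // normr_real.
  by rewrite divr_gt0 // raddfN oppr_gt0.
have aE : forall I, a I = 0.
  apply: a_nz (fun i => Im_upd j i z0 w0) y0 _.
  by rewrite hom_poly_upd -/A -/B divfK // addrN.
move/eqP: B_neq0; case; rewrite /B /hom_poly big1 // => I _.
by rewrite /slice aE mul0rn !mul0r.
Qed.

(* First order term in [e] of [Im_slices_ge0] at the point [1 + 'i e (v, y)]. *)
Lemma neg_correlation_pos D a v y j : stable D a ->
  v j = 0 -> (forall i, i != j -> 0 < v i) -> 0 < y ->
  0 <= (\sum_I slice j false a I * dir_wt D v y I) * (\sum_I slice j true a I) -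
       (\sum_I slice j false a I) * (\sum_I slice j true a I * dir_wt D v y I).
Proof.
move=> a_st vj v0 y0.
have [a0 _ _] := a_st.
have vr i : v i \is Num.real.
  by have [->|/v0/gtr0_real//] := eqVneq i j; rewrite vj real0.
have yr : y \is Num.real by apply: gtr0_real.
pose p b := hom_poly D (polyC \o slice j b a)
    (fun i => 1 + ('i * v i)%:P * 'X) (1 + ('i * y)%:P * 'X) : {poly C}.
have pE b x : (p b).[x] = hom_poly D (slice j b a)
    (fun i => 1 + 'i * v i * x) (1 + 'i * y * x).
  by rewrite horner_hom_poly; apply: eq_hom_poly => [//|i|]; rewrite !hornerE.
have jetE b : (p b).[0] = \sum_I slice j b a I /\
    (p b)^`().[0] = 'i * \sum_I slice j b a I * dir_wt D v y I.
  have [-> ->] := jet_hom_poly D (slice j b a) (fun i => 'i * v i) ('i * y).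
  split=> //; rewrite mulr_sumr; apply: eq_bigr => I _.
  rewrite mulrCA; congr (_ * _); rewrite /dir_wt mulrDr mulrnAr; congr (_ + _).
  by rewrite mulr_sumr; apply: eq_bigr => i _; rewrite mulrnAr.
have sum_real b : \sum_I slice j b a I \is Num.real.
  by apply: ger0_real; apply: sumr_ge0 => I _; apply: slice_ge0.
have dsum_real b : \sum_I slice j b a I * dir_wt D v y I \is Num.real.
  apply: rpred_sum => I _; apply: realM; first exact/ger0_real/slice_ge0.
  by apply: realD; [apply: rpred_sum => i _; apply: rpredMn|apply: rpredMn].
(* Conjugating the coefficients agrees with conjugating the value at real points. *)
pose q := p false * map_poly Num.conj (p true).
have qE x : x \is Num.real -> q.[x] = (p false).[x] * ((p true).[x])^*.
  by move=> xr; rewrite hornerM -{2}(conj_Creal xr) horner_map.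
have q0 : q.[0] \is Num.real.
  by rewrite qE ?real0 // !(proj1 (jetE _)) realM // conj_Creal.
have Im_q0 : 'Im q^`().[0] =
    (\sum_I slice j false a I * dir_wt D v y I) * (\sum_I slice j true a I) -
       (\sum_I slice j false a I) * (\sum_I slice j true a I * dir_wt D v y I).
  rewrite /q derivM hornerD !hornerM deriv_map -(rmorph0 Num.conj) !horner_map
    rmorph0.
  rewrite !(proj1 (jetE _)) !(proj2 (jetE _)) rmorphM /= conjCi.
  rewrite (conj_Creal (sum_real _)) (conj_Creal (dsum_real _)).
  set s0 := \sum_I _; set s1 := \sum_I _; set s2 := \sum_I _;
    set s3 := \sum_I _.
  have -> : 'i * s0 * s1 + s2 * (- 'i * s3) = 'i * (s0 * s1 - s2 * s3) by ring.
  rewrite ImMil; apply/Creal_ReP.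
  exact: realB (realM (dsum_real false) (sum_real true)) (realM (sum_real
    false) (dsum_real true)).
rewrite -Im_q0; apply: Im_coef1_ge0 q0 _ => e e0.
have er : e \is Num.real by apply: gtr0_real.
rewrite qE // !pE.
(* As [v j = 0], the argument at [j] is 1, outside the upper half-plane; it may be replaced by ['i]
   since neither factor depends on it. *)
pose z i : C := if i == j then 'i else 1 + 'i * v i * e.
have zu : (fun i => 1 + 'i * v i * e) =1 upd z j 1.
  by move=> i; rewrite /upd /z; case: eqP => // ->;
    rewrite vj mulr0 mul0r addr0.
rewrite (eq_hom_poly D (a := slice j true a) (fun=> erefl) zu erefl).
rewrite (eq_hom_poly D (a := slice j false a) (fun=> erefl) zu erefl).
have Im1 t : t \is Num.real -> 'Im (1 + 'i * t * e) = t * e.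
  move=> tr; rewrite raddfD /= (Creal_ImP _ (real1 C)) add0r -mulrA ImMil.
  by apply/Creal_ReP; rewrite realM.
rewrite hom_poly_slice_upd0; apply: Im_slices_ge0 => // [i|].
  rewrite /z; case: eqP => [_|/eqP ij]; first by rewrite Im_i ltr01.
  by rewrite Im1 // mulr_gt0 ?v0.
by rewrite Im1 // mulr_gt0.
Qed.

(** The strict case at [(v, y) + e (v1, 1)], which is affine in [e]. *)
Lemma neg_correlation D a v y j : stable D a ->
  v j = 0 -> (forall i, 0 <= v i) -> 0 <= y ->
  (\sum_I slice j false a I) * (\sum_I slice j true a I * dir_wt D v y I) <=
  (\sum_I slice j false a I * dir_wt D v y I) * (\sum_I slice j true a I).
Proof.
move=> a_st vj v0 y0; rewrite -subr_ge0; have [a0 _ _] := a_st.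
have vr i : v i \is Num.real by apply: ger0_real.
have yr : y \is Num.real by apply: ger0_real.
have sum_real b : \sum_I slice j b a I \is Num.real.
  by apply: ger0_real; apply: sumr_ge0 => I _; apply: slice_ge0.
have dsum_real b : \sum_I slice j b a I * dir_wt D v y I \is Num.real.
  apply: rpred_sum => I _; apply: realM; first exact/ger0_real/slice_ge0.
  by apply: realD; [apply: rpred_sum => i _; apply: rpredMn|apply: rpredMn].
pose v1 i : C := (i != j)%:R.
set E := _ - _; pose E1 :=
  (\sum_I slice j false a I * dir_wt D v1 1 I) * (\sum_I slice j true a I) -
  (\sum_I slice j false a I) * (\sum_I slice j true a I * dir_wt D v1 1 I).
have v1j : v1 j = 0 by rewrite /v1 eqxx.
have v10 i : i != j -> 0 < v1 i by rewrite /v1 => ->; rewrite ltr01.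
have E1_ge0 : 0 <= E1 by apply: neg_correlation_pos.
apply: (@ge0_of_perturb _ _ E1) => //; first by rewrite realB // realM.
move=> e e0 _; have eE : forall b, \sum_I slice j b a I * dir_wt D (fun i =>
  v i + e * v1 i) (y + e) I =
    (\sum_I slice j b a I * dir_wt D v y I) + e * (\sum_I slice j b a I *
      dir_wt D v1 1 I).
  move=> b; rewrite mulr_sumr -big_split; apply: eq_bigr => I _ /=.
  rewrite mulrCA -mulrDr; congr (_ * _); rewrite /dir_wt mulrDr addrACA.
  rewrite mulr_sumr -big_split mulrnDl mulrnAr mulr1; congr (_ + _).
  by apply: eq_bigr => i _ /=; rewrite mulrnDl; congr (_ + _);
    apply/esym/mulrnAr.
have := @neg_correlation_pos D a (fun i => v i + e * v1 i) (y + e) j a_st.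
rewrite !eE vj v1j mulr0 addr0 => /(_ erefl).
rewrite (_ : _ * _ - _ = E + e * E1); last by rewrite /E /E1; ring.
apply=> [i ij|]; last by rewrite ltr_wpDl.
by rewrite ltr_wpDl // mulr_gt0 // v10.
Qed.

End NegativeCorrelation.

(** * Negative association *)

Section FederMihailStep.
Variables (R : realFieldType) (n : nat).
Implicit Types (I : n.-tuple bool) (a b G : n.-tuple bool -> R).

Definition mass a : R := \sum_I a I.
Definition expect a G : R := \sum_I a I * G I.

Lemma mass_slice j a : mass a = mass (slice j true a) + mass (slice j false a).
Proof.
rewrite -big_split; apply: eq_bigr => I _; rewrite /slice /=.
by case: (tnth I j); rewrite /= ?addr0 ?add0r.
Qed.

Lemma expect_slice j a G :
  expect a G = expect (slice j true a) G + expect (slice j false a) G.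
Proof.
rewrite -big_split; apply: eq_bigr => I _; rewrite /slice /=.
by case: (tnth I j); rewrite /= ?mulr0n ?mulr1n ?mul0r ?addr0 ?add0r.
Qed.

Lemma mass_ge0 a : (forall I, 0 <= a I) -> 0 <= mass a.
Proof. by move=> a0; apply: sumr_ge0. Qed.

Lemma mass_eq0 a : (forall I, 0 <= a I) -> mass a = 0 -> forall I, a I = 0.
Proof.
by move=> a0 /eqP; rewrite psumr_eq0 // => /allP h I;
  apply/eqP/h/mem_index_enum.
Qed.

Lemma expect_mass0 a G : (forall I, 0 <= a I) -> mass a = 0 -> expect a G = 0.
Proof. by move=> a0 /(mass_eq0 a0) aE; apply: big1 => I _;
  rewrite aE mul0r. Qed.

Lemma mass_gt0 a I : (forall I, 0 <= a I) -> a I != 0 -> 0 < mass a.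
Proof.
move=> a0 aI; rewrite lt0r mass_ge0 // andbT.
by apply: contra aI => /eqP /(mass_eq0 a0) ->.
Qed.

Lemma expect_wt a G : expect a (fun I => (wt I)%:R * G I) =
  \sum_j expect (slice j true a) G.
Proof.
rewrite exchange_big; apply: eq_bigr => I _ /=.
rewrite -mulr_suml mulrA /wt natr_sum mulr_sumr; congr (_ * _).
by apply: eq_bigr => j _; rewrite /slice mulr_natr eqb_id.
Qed.

Lemma cov_slice j a G :
  expect (slice j true a) G * mass a - mass (slice j true a) * expect a G =
  expect (slice j true a) G * mass (slice j false a) -
  mass (slice j true a) * expect (slice j false a) G.
Proof. rewrite (mass_slice j a) (expect_slice j a); ring. Qed.

(* [b] is [a] reweighted by a coordinate or by [D - |I|]. Since [b]
   correlates nonnegatively [G] with [\sum_j I_j], some nondegenerate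
   coordinate [j] of [b] is nonnegatively correlated with [G] under [b], and
   one conditions on it. If every coordinate of [b] is deterministic then [b]
   is a point mass at some [I0], and [a] lives on the [I] that contain [I0]
   up to coordinates ignored by [G]. *)
Lemma feder_mihail_step (J : pred 'I_n) a b G :
  (forall I, 0 <= a I) -> (forall I, 0 <= b I) ->
  {in J, forall j, mass (slice j true b) * mass (slice j false a) <=
                   mass (slice j false b) * mass (slice j true a)} ->
  (forall j, j \notin J -> mass (slice j false b) = 0) ->
  (forall I I', {in J, forall j, tnth I j -> tnth I' j} -> G I <= G I') ->
  expect b (fun I => (wt I)%:R) * expect b G <=
    expect b (fun I => (wt I)%:R * G I) * mass b ->
  {in J, forall j c, 0 < mass (slice j true b) -> 0 < mass (slice j false b) ->
    expect (slice j c b) G * mass (slice j c a) <=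
    mass (slice j c b) * expect (slice j c a) G} ->
  expect b G * mass a <= mass b * expect a G.
Proof.
move=> a0 b0 b_le_a outJ G_incr cov_ge0 IH.
have [mb0|mb_neq0] := eqVneq (mass b) 0.
  by rewrite mb0 expect_mass0 // !mul0r.
have sb0 j c := mass_ge0 (slice_ge0 j c b0).
have [/existsP[j0 j0_free]|/existsPn no_free] :=
  boolP [exists j, (0 < mass (slice j true b)) && (0 < mass (slice j false b))].
  (* Deterministic coordinates have covariance 0 with [G]. If all the others had negative
     covariance, so would the sum, strictly because of [j0]. *)
  have [j /andP[free1 free0] cj] : exists2 j, (0 < mass (slice j true b)) && (0
    < mass (slice j false b)) &
      0 <= expect (slice j true b) G * mass (slice j false b) -
           mass (slice j true b) * expect (slice j false b) G.
    apply/exists_inP; apply: contraLR cov_ge0 => /exists_inPn c_lt0.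
    rewrite -ltNge -subr_lt0 expect_wt.
    have -> : expect b (fun I => (wt I)%:R) = \sum_j mass (slice j true b).
      rewrite -[LHS](eq_bigr _ (fun I _ => congr1 _ (mulr1 _))) -/(expect _ _).
      rewrite expect_wt; apply: eq_bigr => j _; apply: eq_bigr => I _.
      by rewrite mulr1.
    rewrite !mulr_suml -sumrB (eq_bigr _ (fun j _ => cov_slice j b G)).
    rewrite (bigD1 j0) //= ltr_wnDr ?sumr_le0 //; last first.
      by rewrite ltNge; apply: c_lt0.
    move=> j _; have [/c_lt0|] := boolP ((0 < mass (slice j true b)) && (0 <
      mass (slice j false b))).
      by rewrite -ltNge => /ltW.
    rewrite negb_and -!leNgt => /orP[] h; have h0 : mass _ = 0 :=
      le_anti (introT andP (conj h (sb0 _ _))).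
      by rewrite (expect_mass0 G (slice_ge0 j true b0) h0) h0 !mul0r subrr.
    by rewrite (expect_mass0 G (slice_ge0 j false b0) h0) h0 !mulr0 subrr.
  have jJ : j \in J by apply: contraLR free0 => /outJ ->; rewrite ltxx.
  have IH1 := IH j jJ true free1 free0; have IH0 := IH j jJ false free1 free0.
  have := b_le_a j jJ.
  rewrite (expect_slice j b) (mass_slice j a) (mass_slice j b) (expect_slice j
    a).
  move: IH1 IH0 cj free1 free0.
  set g1 := expect (slice j true b) G; set A1 := mass (slice j true a).
  set B1 := mass (slice j true b); set h1 := expect (slice j true a) G.
  set g0 := expect (slice j false b) G; set A0 := mass (slice j false a).
  set B0 := mass (slice j false b); set h0 := expect (slice j false a) G.
  move=> IH1 IH0 cj free1 free0 AB.
  have hh1 : g1 * A1 / B1 <= h1 by rewrite ler_pdivrMr // [leRHS]mulrC.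
  have hh0 : g0 * A0 / B0 <= h0 by rewrite ler_pdivrMr // [leRHS]mulrC.
  (* Bound [h1] and [h0] by the induction hypotheses; what remains factors into the two differences
     that [AB] and [cj] make nonnegative. *)
  apply: (@le_trans _ _ ((B1 + B0) * (g1 * A1 / B1 + g0 * A0 / B0)));
    last first.
    by rewrite ler_wpM2l ?addr_ge0 ?(ltW free1) ?(ltW free0) // lerD.
  rewrite -subr_ge0.
  have -> : (B1 + B0) * (g1 * A1 / B1 + g0 * A0 / B0) - (g1 + g0) * (A1 + A0) =
    (B0 * A1 - B1 * A0) * (g1 * B0 - B1 * g0) / (B1 * B0).
    by field; rewrite !gt_eqF.
  apply: divr_ge0; first by apply: mulr_ge0 => //; rewrite subr_ge0.
  by apply: mulr_ge0; apply: ltW.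
have [I0 bI0] : exists I0, b I0 != 0.
  apply/existsP; apply: contraNT mb_neq0 => /existsPn h.
  by apply/eqP/big1 => I _; apply/eqP/negPn/h.
have slice_pos j : 0 < mass (slice j (tnth I0 j) b).
  apply: (@mass_gt0 _ I0); first exact: slice_ge0.
  by rewrite /slice eqxx mulr1n.
have slice_zero j : mass (slice j (~~ tnth I0 j) b) = 0.
  have := no_free j; have := slice_pos j; rewrite negb_and -!leNgt.
  case: (tnth I0 j) => h; first by rewrite leNgt h /= => h'; apply/le_anti;
    rewrite h' sb0.
  by rewrite [_ || _]orbC leNgt h /= => h'; apply/le_anti; rewrite h' sb0.
have b_point I : I != I0 -> b I = 0.
  move=> I_neq; have [j Ij] : exists j, tnth I j != tnth I0 j.
    apply/existsP; apply: contraNT I_neq => /existsPn h.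
    by apply/eqP/eq_from_tnth => j; apply/eqP/negPn/h.
  have := mass_eq0 (slice_ge0 j (~~ tnth I0 j) b0) (slice_zero j) I.
  by rewrite /slice; move: Ij; case: (tnth I j); case: (tnth I0 j).
have a_above I : a I != 0 -> G I0 <= G I.
  move=> aI; apply: G_incr => j jJ I0j; apply: contraNT aI => Ij; apply/eqP.
  have := b_le_a j jJ; have := slice_zero j; have := slice_pos j.
  rewrite I0j /= => m1 ->; rewrite mul0r pmulr_rle0 // => m0.
  have /mass_eq0 h : mass (slice j false a) = 0.
    by apply/le_anti; rewrite m0 mass_ge0 //; apply: slice_ge0.
  by have := h (slice_ge0 j false a0) I; rewrite /slice (negPf Ij).
have -> : mass b = b I0 by rewrite /mass (bigD1 I0) //= big1 ?addr0.
have -> : expect b G = b I0 * G I0.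
  by rewrite /expect (bigD1 I0) //= big1 ?addr0 // => I /b_point ->;
    rewrite mul0r.
rewrite -mulrA ler_wpM2l // mulr_sumr ler_sum // => I _.
have [->|aI] := eqVneq (a I) 0; first by rewrite mulr0 mul0r.
by rewrite mulrC ler_wpM2l // a_above.
Qed.

End FederMihailStep.

Lemma eq_stable (C : numClosedFieldType) n D (a b : n.-tuple bool -> C) :
  a =1 b -> stable D a -> stable D b.
Proof.
move=> ab [a0 aD a_nz]; split=> [I|I|z y z0 y0 hzy I]; rewrite -?ab;
  first exact: a0.
  exact: aD.
by apply: (a_nz z y) => //; rewrite -[RHS]hzy; apply: eq_hom_poly.
Qed.

Lemma sliceC (S : nmodType) n (i j : 'I_n) b c (a : n.-tuple bool -> S) I :
  slice i b (slice j c a) I = slice j c (slice i b a) I.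
Proof. by rewrite /slice -!mulrnA mulnC. Qed.

Lemma slice_bias (S : nmodType) n (j : 'I_n) b D (a : n.-tuple bool -> S) I :
  slice j b (bias D a) I = bias D (slice j b a) I.
Proof. by rewrite /slice /bias -!mulrnA mulnC. Qed.

(** * The Feder-Mihail induction for stable weights *)

Module NegativeAssociation.
Import complex.
Local Open Scope complex_scope.
Section NegativeAssociation.
Variables (R : rcfType) (n : nat).
Implicit Types (I : n.-tuple bool) (a b G : n.-tuple bool -> R) (D : nat).

Definition stableR D a := stable D (fun I => (a I)%:C : R[i]).

Lemma stableR_ge0 D a : stableR D a -> forall I, 0 <= a I.
Proof. by case=> a0 _ _ I; have := a0 I; rewrite ler0c. Qed.

Lemma stableR_supp D a : stableR D a -> forall I, a I != 0 -> (wt I <= D)%N.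
Proof. by case=> _ aD _ I aI; apply: aD; rewrite fmorph_eq0. Qed.

Lemma stableR_slice j c D a : stableR D a -> stableR D (slice j c a).
Proof.
move=> /(stable_slice j c); apply: eq_stable => I.
by rewrite /slice rmorphMn.
Qed.

Lemma stableR_bias D a : stableR D a -> stableR D.-1 (bias D a).
Proof.
by move=> /stable_bias; apply: eq_stable => I; rewrite /bias rmorphMn.
Qed.

Let neg_cor D a (w : 'I_n -> nat) y j : stableR D a -> w j = 0 ->
  let wt' I := (\sum_i w i * tnth I i + y * (D - wt I))%N in
  mass (slice j false a) * expect (slice j true a) (fun I => (wt' I)%:R) <=
  expect (slice j false a) (fun I => (wt' I)%:R) * mass (slice j true a).
Proof.
move=> a_st wj /=.
have := @neg_correlation _ _ D _ (fun i => (w i)%:R) y%:R j a_st.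
rewrite wj => /(_ erefl) /(_ (fun i => ler0n _ _)) /(_ (ler0n _ _)).
have massE c : \sum_I slice j c (fun I => (a I)%:C) I = (mass (slice j c a))%:C.
  by rewrite rmorph_sum; apply: eq_bigr => I _; rewrite /slice rmorphMn.
have expectE c : \sum_I slice j c (fun I => (a I)%:C) I *
     dir_wt D (fun i => (w i)%:R) y%:R I =
   (expect (slice j c a)
     (fun I => (\sum_i w i * tnth I i + y * (D - wt I))%:R))%:C.
  rewrite rmorph_sum; apply: eq_bigr => I _; rewrite rmorphM /slice rmorphMn.
  congr (_ * _); rewrite rmorph_nat /dir_wt natrD natrM mulr_natr natr_sum.
  by congr (_ + _); apply: eq_bigr => i _; rewrite natrM mulr_natr.
by rewrite !massE !expectE -!rmorphM lecR.
Qed.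

Lemma neg_cor_slice D a e j : stableR D a -> e != j ->
  mass (slice j false a) * mass (slice j true (slice e true a)) <=
  mass (slice j false (slice e true a)) * mass (slice j true a).
Proof.
move=> a_st ej; have := @neg_cor D a (fun i => (i == e)) 0 j a_st.
rewrite eq_sym (negPf ej) => /(_ erefl) /=.
have h c : expect (slice j c a)
    (fun I => (\sum_i (i == e) * tnth I i + 0 * (D - wt I))%:R) =
    mass (slice j c (slice e true a)).
  apply: eq_bigr => I _; rewrite (bigD1 e) //= eqxx mul1n big1 ?addn0 =>
    [|i /negPf ->//].
  by rewrite mulr_natr sliceC /slice eqb_id.
by rewrite !h.
Qed.

Lemma neg_cor_bias D a j : stableR D a ->
  mass (slice j false a) * mass (slice j true (bias D a)) <=
  mass (slice j false (bias D a)) * mass (slice j true a).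
Proof.
move=> a_st; have := @neg_cor D a (fun=> 0%N) 1 j a_st erefl.
have h c : expect (slice j c a)
    (fun I => (\sum_(i < n) 0 * tnth I i + 1 * (D - wt I))%:R) =
    mass (slice j c (bias D a)).
  apply: eq_bigr => I _; rewrite big1 // add0n mul1n.
  by rewrite slice_bias /bias mulr_natr.
by rewrite /= !h.
Qed.

(** Induction measure: conditioning on a nondegenerate coordinate loses a point of the support. *)
Definition support_card a : nat := #|[pred I | a I != 0]|.

Lemma support_card_slice_lt j c a :
  mass (slice j (~~ c) a) != 0 -> (support_card (slice j c a) < support_card
    a)%N.
Proof.
move=> m0; apply: proper_card; apply/properP; split.
  by apply/subsetP => I; rewrite !inE /slice; case: (_ == c);
    rewrite ?mulr0n ?eqxx.
have [I aI] : exists I, slice j (~~ c) a I != 0.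
  apply/existsP; apply: contraNT m0 => /existsPn h.
  by apply/eqP/big1 => I _; apply/eqP/negPn/h.
exists I; move: aI; rewrite !inE /slice; first by case: (_ == ~~ c);
  rewrite ?mulr0n ?eqxx.
by case: c {m0}; case: (tnth I j); rewrite /= ?mulr0n ?eqxx.
Qed.

Lemma mass_slice_mono j c a b : (forall I, 0 <= a I) -> (forall I, 0 <= b I) ->
  (forall I, b I != 0 -> a I != 0) ->
  0 < mass (slice j c b) -> mass (slice j c a) != 0.
Proof.
move=> a0 b0 ba; apply: contraTneq => /(mass_eq0 (slice_ge0 j c a0)) h.
rewrite /mass big1 ?ltxx // => I _; have := h I; rewrite /slice.
case: (_ == c); rewrite ?mulr0n // !mulr1n => aI.
by apply/eqP/negPn/negP => /ba; rewrite aI eqxx.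
Qed.

Definition increasing G :=
  forall I I', (forall j, tnth I j -> tnth I' j) -> G I <= G I'.

Lemma expect_bias D a G : stableR D a -> expect (bias D a) G =
  D%:R * expect a G - expect a (fun I => (wt I)%:R * G I).
Proof.
move=> a_st; rewrite mulr_sumr -sumrB; apply: eq_bigr => I _; rewrite /bias.
have [->|aI] := eqVneq (a I) 0; first by rewrite mul0rn !mul0r mulr0 subrr.
rewrite -[_ *+ (_ - _)]mulr_natr natrB; last exact: (stableR_supp a_st).
by ring.
Qed.

Lemma mass_bias D a : stableR D a ->
  mass (bias D a) = D%:R * mass a - expect a (fun I => (wt I)%:R).
Proof.
move=> /(@expect_bias _ _ (fun=> 1)); rewrite /expect /mass.
rewrite !(eq_bigr _ (fun I _ => mulr1 _)) => ->.
by congr (_ - _); apply: eq_bigr => I _; rewrite mulr1.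
Qed.

(** On the support [K + |I| = D], so the covariances of [G] with [K] and with [|I|] are opposite. *)
Lemma wt_covariance_ge0 D a G : stableR D a ->
  expect (bias D a) G * mass a <= mass (bias D a) * expect a G ->
  expect a (fun I => (wt I)%:R) * expect a G <=
    expect a (fun I => (wt I)%:R * G I) * mass a.
Proof.
move=> a_st; rewrite expect_bias // mass_bias // -subr_ge0 => h.
rewrite -subr_ge0; apply: le_trans h _; rewrite le_eqVlt.
by apply/orP; left; apply/eqP; ring.
Qed.

(** The measure [support_card a + D] drops in both recursive calls: biasing lowers [D] without
    enlarging the support, conditioning shrinks the support. *)
Lemma bias_neg_association D a G : stableR D a -> increasing G ->
  expect (bias D a) G * mass a <= mass (bias D a) * expect a G.
Proof.
have [m] := ubnP (support_card a + D); elim: m D a =>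
  // m IHm D a am a_st G_incr.
have a0 := stableR_ge0 a_st; have b_st := stableR_bias a_st.
have b0 := stableR_ge0 b_st.
have ba I : bias D a I != 0 -> a I != 0.
  by apply: contra => /eqP aI; rewrite /bias aI mul0rn.
apply: (@feder_mihail_step _ _ predT) => // [j _|I I' h||j _ c m1 m0].
- by rewrite mulrC; apply: neg_cor_bias.
- by apply: G_incr => j; apply: h.
- have [D0|D0] := posnP D.
    have bE I : bias D a I = 0 by rewrite /bias D0 mulr0n.
    by rewrite /expect !big1 ?mul0r // => I _; rewrite bE mul0r.
  have sb : (support_card (bias D a) <= support_card a)%N.
    by apply: subset_leq_card; apply/subsetP => I; rewrite !inE; apply: ba.
  by apply: (wt_covariance_ge0 b_st); apply: IHm => //; lia.
have ac := mass_slice_mono a0 b0 ba.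
have sm : (support_card (slice j c a) + D < m)%N.
  have : (support_card (slice j c a) < support_card a)%N.
    by apply: support_card_slice_lt; case: c => /=; apply: ac.
  by lia.
have := IHm _ _ sm (stableR_slice j c a_st) G_incr.
have bE : bias D (slice j c a) =1 slice j c (bias D a).
  by move=> I; rewrite slice_bias.
have -> : mass (bias D (slice j c a)) = mass (slice j c (bias D a)).
  exact: eq_bigr.
have -> : expect (bias D (slice j c a)) G = expect (slice j c (bias D a)) G.
  by apply: eq_bigr => I _; rewrite bE.
by [].
Qed.

(** The hypothesis on [G] also makes it independent of coordinate [e]. The covariance needed under
    [slice e true a] comes from [bias_neg_association], so the support alone is the induction
    measure. *)
Lemma neg_association D a e G : stableR D a ->
  (forall I I', (forall j, j != e -> tnth I j -> tnth I' j) -> G I <= G I') ->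
  expect (slice e true a) G * mass a <= mass (slice e true a) * expect a G.
Proof.
have [m] := ubnP (support_card a); elim: m a => // m IHm a am a_st G_incr.
have a0 := stableR_ge0 a_st; have b_st := stableR_slice e true a_st.
have b0 := stableR_ge0 b_st.
have ba I : slice e true a I != 0 -> a I != 0.
  by apply: contra => /eqP aI; rewrite /slice aI mul0rn.
have G_incr' : increasing G by move=> I I' h; apply: G_incr => j _; apply: h.
apply: (@feder_mihail_step _ _ (predC1 e)) => // [j je|j||j je c m1 m0].
- by rewrite mulrC; apply: (neg_cor_slice a_st); rewrite eq_sym; apply: je.
- rewrite !inE negbK => /eqP ->; apply: big1 => I _.
  by rewrite /slice; case: (tnth I e); rewrite /= ?mulr0n.
- exact: (wt_covariance_ge0 b_st (bias_neg_association b_st G_incr')).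
have ac := mass_slice_mono a0 b0 ba.
have sm : (support_card (slice j c a) < m)%N.
  have : (support_card (slice j c a) < support_card a)%N.
    by apply: support_card_slice_lt; case: c => /=; apply: ac.
  by lia.
have := IHm _ sm (stableR_slice j c a_st) G_incr.
have bE : slice e true (slice j c a) =1 slice j c (slice e true a).
  by move=> I; rewrite sliceC.
have -> : mass (slice e true (slice j c a)) = mass (slice j c (slice e true a)).
  exact: eq_bigr.
have -> : expect (slice e true (slice j c a)) G = expect (slice j c (slice e
  true a)) G.
  by apply: eq_bigr => I _; rewrite bE.
by [].
Qed.

End NegativeAssociation.
End NegativeAssociation.
Export NegativeAssociation.

(** * From real stable generating polynomials to stable weights *)

Module RealStable.
Import complex mpoly.
Local Open Scope complex_scope.
Section RealStable.
Variables (R : archiRcfType) (n : nat).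

Lemma archimedean_complex : Num.archimedean_axiom R[i].
Proof.
move=> z; exists (Num.bound (complex.Re `|z|)).
have z_real := RRe_real (normr_real z).
have z_ge0 : 0 <= complex.Re `|z| by rewrite -ler0c z_real normr_ge0.
by rewrite -{1}z_real -(rmorph_nat (real_complex R)) ltcR archi_boundP.
Qed.

Lemma complex_ImE (z : R[i]) : 'Im z = (complex.Im z)%:C.
Proof.
have real_cplx (x : R) : x%:C \is Num.real by apply/complex_realP; exists x.
by rewrite {1}(complexE z) Im_rect.
Qed.

(** Any [D] will do, as the homogenizing variable is 1. *)
Lemma meval_generating_polynomial (a : n.-tuple bool -> R) (z : 'I_n -> R[i]) D
  :
  (map_mpoly (real_complex R) (generating_polynomial a)).@[z] =
  hom_poly D (fun I => (a I)%:C) z 1.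
Proof.
rewrite /generating_polynomial (raddf_sum (map_mpoly (real_complex R)))
  raddf_sum /=.
apply: eq_bigr => I _.
rewrite map_mpolyZ mevalZ expr1n mulr1 !rmorph_prod /=; congr (_ * _).
by apply: eq_bigr => i _; rewrite !rmorphXn /= map_mpolyX mevalXU.
Qed.

Lemma real_stable_homogenization (a : n.-tuple bool -> R) :
  (forall I, 0 <= a I) -> real_stable (generating_polynomial a) ->
  exists D, stableR D a.
Proof.
move=> a0 a_stable; have [/existsP[I aI]|/existsPn h] :=
  boolP [exists I, a I != 0].
  have [I0 aI0 I0_max] := @arg_maxnP _ I (fun I => a I != 0) (fun I => wt I) aI.
  exists (wt I0); apply: (stable_homogenization (I0 := I0)).
  - by move=> J; rewrite ler0c.
  - by move=> J; rewrite fmorph_eq0; apply: I0_max.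
  - by rewrite fmorph_eq0.
  - by [].
  - move=> z z0; rewrite -meval_generating_polynomial; apply: a_stable => i.
    by have := z0 i; rewrite complex_ImE ltcR.
  - exact: archimedean_complex.
have {}h I : a I = 0 by apply/eqP/negPn/h.
by exists 0%N; split=> [I|I|z y _ _ _ I]; rewrite h // eqxx.
Qed.

End RealStable.
End RealStable.
Export RealStable.

(** * Influence of one coordinate on the others *)

Section ConditioningInfluence.
Variables (R : rcfType) (n D : nat) (a : n.-tuple bool -> R) (e : 'I_n).
Hypothesis a_st : stableR D a.
Implicit Types (I : n.-tuple bool) (F G : n.-tuple bool -> R) (j : 'I_n).

Let a0 := slice e false a.
Let a1 := slice e true a.

(* The unnormalised difference [E(G | I_e = 0) - E(G | I_e = 1)]. *)
Definition influence_of (G : n.-tuple bool -> R) : R :=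
  expect a0 G * mass a1 - expect a1 G * mass a0.

Definition influence j : R := influence_of (fun I => (tnth I j)%:R).

Lemma influence_of_ge0 G :
  (forall I I', (forall j, j != e -> tnth I j -> tnth I' j) -> G I <= G I') ->
  0 <= influence_of G.
Proof.
move=> /(neg_association a_st); rewrite (mass_slice e) (expect_slice e a) -/a0
  -/a1.
by rewrite /influence_of => h; lra.
Qed.

Lemma influence_ge0 j : j != e -> 0 <= influence j.
Proof.
move=> je; apply: influence_of_ge0 => I I' h; rewrite ler_nat.
by have := h j je; case: (tnth I j) => // ->.
Qed.

Lemma influence_ofB F G : influence_of (fun I => F I - G I) =
  influence_of F - influence_of G.
Proof.
have iB b : expect b (fun I => F I - G I) = expect b F - expect b G.
  by rewrite -sumrB; apply: eq_bigr => I _; rewrite mulrBr.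
by rewrite /influence_of !iB; ring.
Qed.

Lemma influence_of_sum (J : pred 'I_n) :
  influence_of (fun I => \sum_(j | J j) (tnth I j)%:R) =
  \sum_(j | J j) influence j.
Proof.
have iS b : expect b (fun I => \sum_(j | J j) (tnth I j)%:R) =
    \sum_(j | J j) expect b (fun I => (tnth I j)%:R).
  by rewrite exchange_big; apply: eq_bigr => I _; rewrite mulr_sumr.
by rewrite /influence_of !iS !mulr_suml -sumrB.
Qed.

Lemma influence_of1 : influence_of (fun=> 1) = 0.
Proof.
have i1 b : expect b (fun=> 1) = mass b.
  by apply: eq_bigr => I _; rewrite mulr1.
by rewrite /influence_of !i1 mulrC subrr.
Qed.

(* [\sum_(j | J j) X_j - F] is increasing because a change of some [X_j] with
   [j] in [J] outweighs the oscillation of [F]. *)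
Lemma influence_of_le (J : pred 'I_n) F : ~~ J e ->
  (forall I, 0 <= F I <= 1) ->
  (forall I I', (forall j, J j -> tnth I j = tnth I' j) -> F I = F I') ->
  influence_of F <= \sum_(j | J j) influence j.
Proof.
move=> Je F01 FJ; rewrite -subr_ge0 -influence_of_sum -influence_ofB.
apply: influence_of_ge0 => I I' h.
have hJ j : J j -> tnth I j -> tnth I' j.
  by move=> Jj; apply: h; apply: contraTneq Jj => ->.
have [eqJ|neqJ] := boolP [forall (j | J j), tnth I j == tnth I' j].
  move/forall_inP: eqJ => eqJ; rewrite (FJ I I') => [|j /eqJ/eqP //].
  by rewrite lerD2r; apply: ler_sum => j Jj; rewrite (eqP (eqJ j Jj)).
have /exists_inP[j Jj Ij] : [exists (j | J j), tnth I j != tnth I' j].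
  by rewrite -negb_forall_in.
have le1 : \sum_(j | J j) (tnth I j)%:R + 1 <= \sum_(j | J j) (tnth I' j)%:R :>
  R.
  rewrite (bigD1 j) // [leRHS](bigD1 j) //= addrAC lerD //.
    by move: (hJ j Jj) Ij; case: (tnth I j) => [/(_ isT)->//|_];
      case: (tnth I' j); rewrite ?add0r.
  apply: ler_sum => i /andP[Ji _]; rewrite ler_nat.
  by have := hJ i Ji; case: (tnth I i) => // ->.
have /andP[F0 F1] := F01 I'; have /andP[F0' F1'] := F01 I.
by lra.
Qed.

(** Constants have no influence, so the one-sided bound for [1 - F] is the other side. *)
Lemma norm_influence_of_le (J : pred 'I_n) F : ~~ J e ->
  (forall I, 0 <= F I <= 1) ->
  (forall I I', (forall j, J j -> tnth I j = tnth I' j) -> F I = F I') ->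
  `|influence_of F| <= \sum_(j | J j) influence j.
Proof.
move=> Je F01 FJ; rewrite ler_norml influence_of_le // andbT lerNl.
have -> : - influence_of F = influence_of (fun I => 1 - F I).
  by rewrite influence_ofB influence_of1 sub0r.
apply: influence_of_le => //.
  by move=> I; have /andP[F0 F1] := F01 I; apply/andP; split; lra.
by move=> I I' /FJ ->.
Qed.

(** Negative correlation of [I_e] with [K] says that the influence on [|I|] is at most 0, and the
    share of [e] itself in it is [- (mass a1 * mass a0)]. *)
Lemma sum_influence_le : \sum_(j | j != e) influence j <= mass a1 * mass a0.
Proof.
have := neg_cor_bias e a_st.
have hK c : mass (slice e c (bias D a)) = D%:R * mass (slice e c a) -
    expect (slice e c a) (fun I => \sum_j (tnth I j)%:R).
  have -> : mass (slice e c (bias D a)) = mass (bias D (slice e c a)).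
    by apply: eq_bigr => I _; rewrite slice_bias.
  rewrite (mass_bias (stableR_slice e c a_st)); congr (_ - _).
  by apply: eq_bigr => I _; rewrite natr_sum.
rewrite !hK -/a0 -/a1 => h.
have : influence_of (fun I => \sum_j (tnth I j)%:R) <= 0 by rewrite
  /influence_of; lra.
rewrite influence_of_sum (bigD1 e) //=.
suff -> : influence e = - (mass a1 * mass a0) by lra.
have -> : influence e = expect a0 (fun I => (tnth I e)%:R) * mass a1 -
   expect a1 (fun I => (tnth I e)%:R) * mass a0 by [].
have -> : expect a0 (fun I => (tnth I e)%:R) = 0.
  by apply: big1 => I _; rewrite /a0 /slice; case: (tnth I e);
    rewrite /= ?mulr0n ?mul0r ?mulr0.
have -> : expect a1 (fun I => (tnth I e)%:R) = mass a1.
  by apply: eq_bigr => I _; rewrite /a1 /slice; case: (tnth I e);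
    rewrite /= ?mulr0n ?mul0r ?mulr1.
by rewrite mul0r sub0r.
Qed.

End ConditioningInfluence.

Section PrefixConditioning.
Variables (R : rcfType) (n : nat).

Definition agrees (c : nat -> bool) (k : nat) (I : n.-tuple bool) : bool :=
  [forall i : 'I_n, (i < k)%N ==> (tnth I i == c i)].

Lemma stableR_agrees D (a : n.-tuple bool -> R) c k : stableR D a ->
  stableR D (fun I => a I *+ agrees c k I).
Proof.
move=> a_st; elim: k => [|k IHk].
  apply: eq_stable a_st => I; rewrite /agrees.
  by rewrite (_ : [forall i, _]) //; apply/forallP.
have [kn|nk] := ltnP k n.
  apply: eq_stable (stableR_slice (Ordinal kn) (c k) IHk) => I.
  rewrite /slice -mulrnA mulnb; congr (complex.real_complex_def _ (_ *+
    nat_of_bool _)).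
  apply/andP/forallP => [[/forallP h /eqP hk] i|h].
    apply/implyP; rewrite ltnS leq_eqVlt => /orP[/eqP ik|ik];
      last exact: (implyP (h i)).
    by rewrite ik -hk; apply/eqP; congr tnth; apply: val_inj.
  split; last exact: (implyP (h (Ordinal kn)) (ltnSn k)).
  by apply/forallP => i; apply/implyP => ik; apply: (implyP (h i)); apply: ltnW.
apply: eq_stable IHk => I; congr (complex.real_complex_def _ (_ *+ nat_of_bool
  _)).
apply: eq_forallb => i; have ik : (i < k)%N by apply: leq_trans nk.
by rewrite ltnS ik ltnW.
Qed.

End PrefixConditioning.

From mathcomp Require Import all_classical all_reals all_analysis.
Local Open Scope classical_set_scope.

(** * Tail events *)

Section RealProbability.
Context d (T : measurableType d) (R : realType) (P : probability T R).
Implicit Types A B : set T.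

Definition pr A : R := fine (P A).

Lemma prE A : measurable A -> P A = (pr A)%:E.
Proof. by move=> mA; rewrite fineK // fin_num_measure. Qed.

Lemma pr_ge0 A : 0 <= pr A.
Proof. by rewrite fine_ge0. Qed.

Lemma pr_setT : pr setT = 1.
Proof. by rewrite /pr probability_setT. Qed.

Lemma pr_set0 : pr set0 = 0.
Proof. by rewrite /pr measure0. Qed.

Lemma pr_le A B : measurable A -> measurable B -> A `<=` B -> pr A <= pr B.
Proof.
by move=> mA mB AB; rewrite -lee_fin -!prE // le_measure // inE.
Qed.

Lemma prU A B : measurable A -> measurable B -> A `&` B = set0 ->
  pr (A `|` B) = pr A + pr B.
Proof.
move=> mA mB AB; apply: EFin_inj; rewrite EFinD -!prE ?measureU //.
exact: measurableU.
Qed.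

Lemma pr_split A B : measurable A -> measurable B ->
  pr A = pr (A `&` B) + pr (A `\` B).
Proof.
move=> mA mB; rewrite -prU; [|exact: measurableI|exact: measurableD|].
  by rewrite setUC setDE -setIUr setvU setIT.
by rewrite setDE setIACA setICr setI0.
Qed.

Lemma pr_leU A B : measurable A -> measurable B -> pr (A `|` B) <= pr A + pr B.
Proof.
move=> mA mB; have -> : A `|` B = A `|` (B `\` A).
  apply/seteqP; split=> x /=; last by case=> [|[]]; [left|right].
  by case=> [|Bx]; [left|have [|] := pselect (A x); [left|right]].
rewrite prU ?lerD2l //; first by apply: pr_le => //; exact: measurableD.
  exact: measurableD.
by rewrite setDE setIC -setIA setICl setI0.
Qed.

Definition sym_diff A B : R := pr (A `\` B) + pr (B `\` A).

Lemma pr_sym_diff A B C : measurable A -> measurable B -> measurable C ->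
  `|pr (C `&` A) - pr (C `&` B)| <= sym_diff A B.
Proof.
have half A' B' : measurable A' -> measurable B' -> measurable C ->
    pr (C `&` A') <= pr (C `&` B') + pr (A' `\` B').
  move=> mA mB mC; rewrite (le_trans _ (pr_leU _ _)) //; last 2 first.
  - exact: measurableI.
  - exact: measurableD.
  apply: pr_le => [||x [Cx Ax] /=]; first exact: measurableI.
    by apply: measurableU; [exact: measurableI|exact: measurableD].
  by have [Bx|Bx] := pselect (B' x); [left|right].
move=> mA mB mC; have h1 := half A B mA mB mC; have h2 := half B A mB mA mC.
have h3 := pr_ge0 (A `\` B); have h4 := pr_ge0 (B `\` A).
by rewrite ler_norml /sym_diff; apply/andP; split; lra.
Qed.

Lemma pr_bigcup_approx (F : (set T)^nat) (eps : R) : (forall n,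
  measurable (F n)) ->
  0 < eps ->
  exists n, pr (\bigcup_k F k `\` \big[setU/set0]_(k < n.+1) F k) <= eps.
Proof.
move=> mF eps0; pose U n := \big[setU/set0]_(k < n.+1) F k.
have mU n : measurable (U n) by apply: bigsetU_measurable.
have UE : \bigcup_n U n = \bigcup_k F k by exact: bigcup_bigsetU_bigcup.
have mE : measurable (\bigcup_k F k) by exact: bigcupT_measurable.
have ndU : nondecreasing_seq U.
  by move=> i j ij; apply/subsetPset; rewrite /U -!bigcup_mkord;
     apply: bigcup_subset => k /=; lia.
have : P \o U @ \oo --> P (\bigcup_n U n).
  by apply: nondecreasing_cvg_mu => //; rewrite UE.
rewrite UE prE // => /fine_cvgP[_ /cvgrPdist_le/(_ _ eps0)[n _ /(_ n (leqnn
  n))]].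
rewrite /= -/(pr (U n)) => h; exists n; rewrite -/(U n).
have := pr_split mE (mU n).
have -> : \bigcup_k F k `&` U n = U n.
  by apply: setIidr; rewrite -UE; apply: bigcup_sup.
move=> hE; have := le_trans (ler_norm _) h; rewrite hE => {}h.
by apply: le_trans h; rewrite addrAC subrr add0r.
Qed.

End RealProbability.

(** * Cylinder events and approximation by them *)

Section Cylinders.
Context d (T : measurableType d) (R : realType) (P : probability T R).
Variable X : nat -> {RV P >-> bool}.
Implicit Types (g : (nat -> bool) -> bool) (E : set T).

Definition trajectory x : nat -> bool := fun i => X i x.

Definition cyl g : set T := [set x | g (trajectory x)].

(** Cylinders are coded by functions of whole sequences, so that a window can be enlarged without
    changing [g]. *)
Definition depends_on m N g := forall u v : nat -> bool,
  (forall i, (m <= i < N)%N -> u i = v i) -> g u = g v.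

(** The default [false] beyond [n] is invisible to functions whose window ends by [n]. *)
Definition tuple_path n (I : n.-tuple bool) : nat -> bool :=
  fun i => nth false I i.

Definition prefix_weight n (I : n.-tuple bool) : R :=
  fine (distribution P (prefix_vector X n) [set I]).

Let measurable_atom n (I : n.-tuple bool) :
  measurable (prefix_vector X n @^-1` [set I]).
Proof.
have -> : prefix_vector X n @^-1` [set I] =
    \bigcap_(i in [set: 'I_n]) (X i @^-1` [set tnth I i]).
  apply/seteqP; split=> x /= h.
    by move=> i _ /=; rewrite -h tnth_mktuple.
  by apply: eq_from_tnth => i; rewrite tnth_mktuple; exact: (h i).
apply: fin_bigcap_measurable; first exact: finite_finset.
by move=> i _; rewrite -[X in measurable X]setTI; exact: measurable_funPT.
Qed.

Let pr_prefix_seq n (s : seq (n.-tuple bool)) : uniq s ->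
  measurable [set x | prefix_vector X n x \in s] /\
  pr P [set x | prefix_vector X n x \in s] = \sum_(I <- s) prefix_weight I.
Proof.
elim: s => [|I s IHs] /=.
  rewrite big_nil (_ : [set _ | _] = set0) ?pr_set0 //.
  by apply/seteqP; split.
move=> /andP[Is /IHs[ms prs]].
have -> : [set x | prefix_vector X n x \in I :: s] =
    prefix_vector X n @^-1` [set I] `|` [set x | prefix_vector X n x \in s].
  apply/seteqP; split=> x /=; rewrite inE.
    by case/orP => [/eqP|]; [left|right].
  by case=> [->|->]; rewrite ?eqxx ?orbT.
have mI := measurable_atom I.
split; first exact: measurableU.
rewrite prU // ?big_cons ?prs //.
apply/seteqP; split=> // x /= [xI].
by rewrite xI (negPf Is).
Qed.


Let cylE m N g : depends_on m N g -> cyl g =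
  [set x | prefix_vector X N x \in enum [pred I : N.-tuple bool | g (tuple_path
    I)]].
Proof.
move=> dep_g.
have h x : g (trajectory x) = g (tuple_path (prefix_vector X N x)).
  apply: dep_g => i /andP[_ iN].
  by rewrite /tuple_path -(tnth_nth _ _ (Ordinal iN)) tnth_mktuple.
by apply/seteqP; split=> x /=; rewrite mem_enum inE -h.
Qed.

Lemma measurable_cyl m N g : depends_on m N g -> measurable (cyl g).
Proof. by move=> /cylE ->; apply: (proj1 (pr_prefix_seq (enum_uniq _))). Qed.

Lemma pr_cyl m N g : depends_on m N g ->
  pr P (cyl g) = \sum_(I : N.-tuple bool) prefix_weight I *+ g (tuple_path I).
Proof.
move=> /cylE ->; rewrite (proj2 (pr_prefix_seq (enum_uniq _))) big_enum /=.
by rewrite big_mkcond; apply: eq_bigr => I _; rewrite inE; case: (g _).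
Qed.

Lemma prefix_weight_ge0 n (I : n.-tuple bool) : 0 <= prefix_weight I.
Proof. exact: fine_ge0. Qed.

Lemma cylI g h : cyl g `&` cyl h = cyl (fun u => g u && h u).
Proof.
by apply/seteqP; split=> x /=; [move=> [gx hx]; apply/andP|move=> /andP].
Qed.

Lemma depends_onW m m' N N' g : (m' <= m)%N -> (N <= N')%N ->
  depends_on m N g -> depends_on m' N' g.
Proof.
move=> mm NN dep_g u v uv; apply: dep_g => i /andP[mi iN]; apply: uv.
by rewrite (leq_trans mm) // (leq_trans iN).
Qed.

Lemma depends_onI m N g h : depends_on m N g -> depends_on m N h ->
  depends_on m N (fun u => g u && h u).
Proof. by move=> dg dh u v uv; rewrite (dg u v) // (dh u v). Qed.

Definition approximable m : set_system T := [set E | measurable E /\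
  forall eps : R, 0 < eps -> exists N g,
    depends_on m N g /\ sym_diff P E (cyl g) <= eps].

Let sym_diffU (A A' B B' : set T) : measurable A -> measurable A' ->
  measurable B -> measurable B' ->
  sym_diff P (A `|` A') (B `|` B') <= sym_diff P A B + sym_diff P A' B'.
Proof.
have half (A1 A2 B1 B2 : set T) : measurable A1 -> measurable A2 ->
    measurable B1 -> measurable B2 ->
    pr P ((A1 `|` A2) `\` (B1 `|` B2)) <= pr P (A1 `\` B1) + pr P (A2 `\` B2).
  move=> m1 m2 m3 m4; rewrite (le_trans _ (pr_leU _ _ _)) //; last 2 first.
  - exact: measurableD.
  - exact: measurableD.
  apply: pr_le => [||x [[] Ax /not_orP[B1x B2x]]]; [|by apply: measurableU;
    exact: measurableD|by left|by right].
  by apply: measurableD; exact: measurableU.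
move=> m1 m2 m3 m4; have h1 := half A A' B B' m1 m2 m3 m4.
by have h2 := half B B' A A' m3 m4 m1 m2; rewrite /sym_diff; lra.
Qed.

Let approximableU m A B : approximable m A -> approximable m B ->
  approximable m (A `|` B).
Proof.
move=> [mA hA] [mB hB]; split; first exact: measurableU.
move=> eps eps0; have eps2 : 0 < eps / 2 by rewrite divr_gt0.
have [N [g [dg hg]]] := hA _ eps2; have [N' [h [dh hh]]] := hB _ eps2.
exists (maxn N N'), (fun u => g u || h u); split.
  move=> u v uv; rewrite (depends_onW (leqnn m) (leq_maxl N N') dg uv).
  by rewrite (depends_onW (leqnn m) (leq_maxr N N') dh uv).
have -> : cyl (fun u => g u || h u) = cyl g `|` cyl h.
  by apply/seteqP; split=> x /=; [move/orP|move=> ?; apply/orP].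
rewrite (le_trans (sym_diffU _ _ _ _)) //; [exact: measurable_cyl dg|exact:
  measurable_cyl dh|].
by rewrite [leRHS]splitr lerD.
Qed.

(** Approximable events contain the generators and form a sigma-algebra: a countable union is cut at
    a finite stage at cost [eps / 2], and the finite union is approximated within [eps / 2]. *)
Lemma sigma_from_approximable m E : sigma_from X m E -> approximable m E.
Proof.
apply: smallest_sub; last first.
  move=> A [i /= mi [B mB <-]]; rewrite setTI; split.
    by rewrite -[X in measurable X]setTI; exact: measurable_funPT.
  move=> eps eps0; exists i.+1, (fun u => u i \in B); split.
    by move=> u v uv; rewrite uv // mi ltnSn.
  have -> : cyl (fun u => u i \in B) = X i @^-1` B.
    by apply/seteqP; split=> x; [exact: set_mem|exact: mem_set].
  by rewrite /sym_diff !setDv pr_set0 addr0 ltW.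
have approx0 : approximable m set0.
  split=> // eps eps0; exists 0%N, (fun=> false); split=> //.
  have -> : cyl (fun=> false) = set0 by apply/seteqP; split.
  by rewrite /sym_diff !setDv pr_set0 addr0 ltW.
split=> // [A [mA hA]|F hF].
  split; first by rewrite setTD; exact: measurableC.
  move=> eps eps0; have [N [g [dg hg]]] := hA _ eps0.
  exists N, (fun u => ~~ g u); split; first by move=> u v /dg ->.
  have -> : cyl (fun u => ~~ g u) = ~` cyl g.
    by apply/seteqP; split=> x /=; [move/negP|move=> ?; apply/negP].
  have setDCC (B B' : set T) : ~` B `\` ~` B' = B' `\` B.
    by rewrite !setDE setCK setIC.
  by rewrite /sym_diff setTD !setDCC addrC.
have mF n : measurable (F n) by case: (hF n).
split; first exact: bigcupT_measurable.
move=> eps eps0; have eps2 : 0 < eps / 2 by rewrite divr_gt0.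
have [n hn] := pr_bigcup_approx P mF eps2.
set U := \big[setU/set0]_(k < n.+1) F k in hn.
have [mU hU] : approximable m U by apply: big_ind => // *; exact: approximableU.
have [N [g [dg hg]]] := hU _ eps2; exists N, g; split=> //.
have mg := measurable_cyl dg.
have mE : measurable (\bigcup_k F k) by exact: bigcupT_measurable.
have UE : U `<=` \bigcup_k F k.
  by rewrite /U -bigcup_mkord; apply: bigcup_subset.
have h1 : pr P (\bigcup_k F k `\` cyl g) <= pr P (\bigcup_k F k `\` U) + pr P
  (U `\` cyl g).
  rewrite (le_trans _ (pr_leU _ _ _)) //; [|exact: measurableD|exact:
    measurableD].
  apply: pr_le => [||x [Ex gx]]; first exact: measurableD.
    by apply: measurableU; exact: measurableD.
  by have [Ux|Ux] := pselect (U x); [right|left].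
have h2 : pr P (cyl g `\` \bigcup_k F k) <= pr P (cyl g `\` U).
  apply: pr_le => [||x [gx Ex]]; [exact: measurableD|exact: measurableD|].
  by split=> // /UE.
by move: hg hn; rewrite /sym_diff => hg hn; lra.
Qed.

End Cylinders.

(** Start the tail where a partial sum is within [eps] of the supremum. *)
Lemma bounded_sum_tail (R : realType) (u : nat -> R) (k : nat) (M eps : R) :
  (forall j, (k <= j)%N -> 0 <= u j) ->
  (forall N, \sum_(k <= j < N) u j <= M) -> 0 < eps ->
  exists2 m, (k <= m)%N & forall N, \sum_(m <= j < N) u j <= eps.
Proof.
move=> u0 uM eps0; pose s N := \sum_(k <= j < N) u j.
have sup_s : has_sup (range s).
  by split; [exists (s 0%N); exists 0%N | exists M => _ [N _ <-]; apply: uM].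
have [_ [N0 _ <-] hN0] := sup_adherent eps0 sup_s.
have cat_s m N : (k <= m <= N)%N -> s N = s m + \sum_(m <= j < N) u j.
  by move=> /andP[km mN]; rewrite /s (big_cat_nat km mN).
have tail_ge0 m N : (k <= m)%N -> 0 <= \sum_(m <= j < N) u j.
  move=> km; rewrite big_nat_cond sumr_ge0 // => j /andP[/andP[mj _] _].
  exact: u0 (leq_trans km mj).
exists (maxn k N0) => [|N]; first exact: leq_maxl.
have [mN|Nm] := leqP (maxn k N0) N; last by rewrite big_geq ?ltW // ltnW.
have sN : s N <= sup (range s) by apply: ub_le_sup; [case: sup_s|exists N].
have sm : s N0 <= s (maxn k N0).
  have [kN0|N0k] := leqP k N0; last by rewrite /s !big_geq ?lexx // ltnW.
  exact: lexx.
have := @cat_s (maxn k N0) N; rewrite leq_maxl mN => /(_ isT) sE.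
by rewrite sE in sN; lra.
Qed.

(** * Independence from prefixes and the zero-one law *)

Section TailTriviality.
Context d (T : measurableType d) (R : realType) (P : probability T R).
Variable X : nat -> {RV P >-> bool}.
Hypothesis hX : strongly_rayleigh_sequence X.
Implicit Types (g : (nat -> bool) -> bool) (E : set T) (c : nat -> bool) (k :
  nat).

Local Notation pr := (pr P).
Local Notation cyl := (cyl X).

Definition starts_with c k (u : nat -> bool) : bool :=
  [forall i : 'I_k, u i == c i].

Definition starts_with_next c k b (u : nat -> bool) : bool :=
  starts_with c k u && (u k == b).

Lemma depends_on_starts_with c k : depends_on 0 k (starts_with c k).
Proof. by move=> u v uv; apply: eq_forallb => i; rewrite uv /=. Qed.

Lemma depends_on_starts_with_next c k b : depends_on 0 k.+1 (starts_with_next c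
  k b).
Proof.
move=> u v uv; rewrite /starts_with_next (uv k) ?leqnn //.
by rewrite (@depends_on_starts_with c k u v) // => i ik; apply: uv; lia.
Qed.

Section Influence.
Variables (c : nat -> bool) (k : nat).

Let S b := cyl (starts_with_next c k b).

Let mS b : measurable (S b).
Proof. exact: measurable_cyl (@depends_on_starts_with_next c k b). Qed.

(** Stated with [P] rather than with sums over [N]-tuples, so that the terms of the series do not
    change with [N]. *)
Definition event_influence E : R :=
  pr (S false `&` E) * pr (S true) - pr (S true `&` E) * pr (S false).

Section Finite.
Variables (N : nat) (kN : (k < N)%N).

Let e := Ordinal kN.

Let a (I : N.-tuple bool) : R :=
  prefix_weight X I *+ agrees c k I.

Let slice_a b I : slice e b a I =
  prefix_weight X I *+ starts_with_next c k b (tuple_path I).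
Proof.
rewrite /slice /a -mulrnA mulnb /starts_with_next /tuple_path (tnth_nth false).
congr (_ *+ nat_of_bool (_ && _)); apply/forallP/forallP => h i.
  have := h (widen_ord (ltnW kN) i); rewrite /= ltn_ord /= => /eqP <-.
  by rewrite (tnth_nth false).
by apply/implyP => ik; rewrite (tnth_nth false); apply: (h (Ordinal ik)).
Qed.

Let mass_slice_a b : mass (slice e b a) = pr (S b).
Proof.
rewrite (pr_cyl X (depends_onW (leqnn 0) kN (@depends_on_starts_with_next c k
  b))).
by apply: eq_bigr => I _; rewrite slice_a.
Qed.

Let expect_slice_a m b g : depends_on m N g ->
  expect (slice e b a) (fun I => (g (tuple_path I))%:R) = pr (S b `&` cyl g).
Proof.
move=> dg; rewrite /S cylI (@pr_cyl _ _ _ _ _ 0 N); last first.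
  apply: depends_onI (depends_onW _ (leqnn N) dg); last by [].
  exact: depends_onW (leqnn 0) kN (@depends_on_starts_with_next c k b).
by apply: eq_bigr => I _; rewrite slice_a mulr_natr -mulrnA mulnb.
Qed.

Lemma event_influence_cyl m g : depends_on m N g ->
  influence_of a e (fun I => (g (tuple_path I))%:R) = event_influence (cyl g).
Proof.
by move=> dg; rewrite /influence_of !mass_slice_a !(expect_slice_a _ dg).
Qed.

Lemma event_influence_coord (j : 'I_N) :
  influence a e j = event_influence (cyl (fun u => u j)).
Proof.
rewrite -(@event_influence_cyl 0); last by move=> u v ->;
  rewrite // leq0n ltn_ord.
rewrite /influence; congr influence_of; apply/funext => I.
by rewrite /tuple_path (tnth_nth false).
Qed.

Let a_stable : exists D, stableR D a.
Proof.
have [D hD] := real_stable_homogenization (@prefix_weight_ge0 _ _ _ _ X N) (@hX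
  N).
by exists D; apply: stableR_agrees.
Qed.

Lemma event_influence_finite m g : (k < m)%N -> depends_on m N g ->
  `|event_influence (cyl g)| <=
    \sum_(m <= j < N) event_influence (cyl (fun u => u j)).
Proof.
move=> km dg; have [D a_st] := a_stable.
rewrite -(event_influence_cyl dg).
have := @norm_influence_of_le _ _ _ _ e a_st (fun j => (m <= j)%N)
  (fun I => (g (tuple_path I))%:R).
rewrite -ltnNge /= km => /(_ isT); rewrite big_geq_mkord.
rewrite (eq_bigr (fun j : 'I_N => event_influence (cyl (fun u => u j)))) =>
  [|j _].
  apply=> [I|I I' h]; first by case: (g _); rewrite /= ?lexx ?ler01.
  congr ((nat_of_bool _)%:R); apply: dg => i /andP[mi iN].
  by have := h (Ordinal iN) mi; rewrite !(tnth_nth false).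
exact: event_influence_coord.
Qed.

Lemma event_influence_coord_ge0 j : (k < j < N)%N ->
  0 <= event_influence (cyl (fun u => u j)).
Proof.
move=> /andP[kj jN]; have [D a_st] := a_stable.
have := @influence_ge0 _ _ _ _ e a_st (Ordinal jN);
  rewrite event_influence_coord.
by apply; rewrite -val_eqE /= gtn_eqF.
Qed.

Lemma sum_event_influence_le1 :
  \sum_(k.+1 <= j < N) event_influence (cyl (fun u => u j)) <= 1.
Proof.
have [D a_st] := a_stable; have := sum_influence_le e a_st.
rewrite !mass_slice_a => le1.
have pr_le1 b : pr (S b) <= 1 by rewrite -(pr_setT P); apply: pr_le.
apply: (@le_trans _ _ (pr (S true) * pr (S false))); last first.
  by rewrite mulr_ile1 ?pr_ge0.
apply: le_trans le1; rewrite big_geq_mkord.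
(* The terms with [j < k] are nonnegative and are discarded. *)
rewrite [leRHS](bigID (fun j : 'I_N => (k < j)%N)) /= -[leLHS]addr0 lerD //;
  last first.
  by apply: sumr_ge0 => j /andP[je _]; exact: (influence_ge0 a_st je).
rewrite le_eqVlt; apply/orP; left; apply/eqP; apply: eq_big => [j|j _].
  by rewrite -val_eqE /=; lia.
by rewrite event_influence_coord.
Qed.

End Finite.

Lemma event_influence_sym_diff A B : measurable A -> measurable B ->
  `|event_influence A - event_influence B| <= sym_diff P A B + sym_diff P A B.
Proof.
move=> mA mB; have pr_le1 b : pr (S b) <= 1 by rewrite -(pr_setT P);
  apply: pr_le.
rewrite /event_influence.
have -> : forall x0 x1 y0 y1 s0 s1 : R, x0 * s1 - x1 * s0 - (y0 * s1 - y1 * s0)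
  =
   (x0 - y0) * s1 - (x1 - y1) * s0 by move=> *; ring.
rewrite (le_trans (ler_normB _ _)) // !normrM lerD //.
  rewrite -[leRHS]mulr1 ler_pM ?normr_ge0 ?(pr_sym_diff P mA mB) //.
  by rewrite ger0_norm ?pr_ge0.
rewrite -[leRHS]mulr1 ler_pM ?normr_ge0 ?(pr_sym_diff P mA mB) //.
by rewrite ger0_norm ?pr_ge0.
Qed.

Lemma event_influence_tail E : tail_sigma_field X E -> event_influence E = 0.
Proof.
move=> tE; apply/eqP; rewrite -normr_eq0 eq_le normr_ge0 andbT.
apply/ler_addgt0Pl => eps eps0; rewrite addr0.
(* One third for the cylinder, two for replacing [E] by it in the two terms of the influence. [m] is
   chosen before the cylinder, which is possible as [E] lies in every [sigma_from X m]. *)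
have eps3 : 0 < eps / 3 by rewrite divr_gt0.
have [m km hm] : exists2 m, (k < m)%N & forall N,
    \sum_(m <= j < N) event_influence (cyl (fun u => u j)) <= eps / 3.
  apply: (bounded_sum_tail (M := 1)) => // [j kj|N].
    by apply: (@event_influence_coord_ge0 j.+1); rewrite ?kj ?ltnSn // ltnW.
  have [kN|Nk] := ltnP k N; first exact: sum_event_influence_le1.
  by rewrite big_geq ?ler01 // ltnW.
have [mE hE] := sigma_from_approximable (tE m I).
have [N [g [dg hg]]] := hE _ eps3.
(* [N] may be at most [k]; enlarging the window brings coordinate [k] into range. *)
have kN' : (k < maxn N k.+1)%N by rewrite leq_maxr.
have dg' := depends_onW (leqnn m) (leq_maxl N k.+1) dg.
have h1 := le_trans (event_influence_finite kN' km dg') (hm _).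
have h2 := event_influence_sym_diff mE (measurable_cyl X dg).
have h3 := ler_normD (event_influence E - event_influence (cyl g))
  (event_influence (cyl g)).
rewrite subrK in h3.
by apply: le_trans h3 _; lra.
Qed.

End Influence.

Lemma tail_measurable E : tail_sigma_field X E -> measurable E.
Proof. by move=> /(_ 0%N I) /sigma_from_approximable[]. Qed.

(** Zero influence means that revealing [X_k] after the prefix does not change the conditional
    probability of [E]. *)
Lemma tail_independent_prefix E c k : tail_sigma_field X E ->
  pr (cyl (starts_with c k) `&` E) = pr (cyl (starts_with c k)) * pr E.
Proof.
move=> tE; have mE := tail_measurable tE; elim: k c => [|k IHk] c.
  have -> : cyl (starts_with c 0) = setT.
    by apply/seteqP; split=> // x _; apply/forallP => -[].
  by rewrite setTI pr_setT mul1r.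
pose S b := cyl (starts_with_next c k b).
have mS b : measurable (S b).
  exact: measurable_cyl (@depends_on_starts_with_next c k b).
have SE : cyl (starts_with c k.+1) = S (c k).
  apply/seteqP; split=> x /=.
    move=> /forallP h; apply/andP; split; last exact: (h ord_max).
    by apply/forallP => i; exact: (h (widen_ord (leqnSn k) i)).
  move=> /andP[/forallP h hk]; apply/forallP => i.
  have [ik|ki] := ltnP i k; first exact: (h (Ordinal ik)).
  by have -> : i = k :> nat by apply/eqP; rewrite eqn_leq ki -ltnS ltn_ord.
have splitS B : measurable B -> pr (cyl (starts_with c k) `&` B) =
    pr (S true `&` B) + pr (S false `&` B).
  move=> mB; rewrite -prU; [|exact: measurableI|exact: measurableI|].
    congr pr; apply/seteqP; split=> x /=.
      by move=> [hx Bx]; rewrite /S /cyl /= /starts_with_next hx;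
        case: (_ x k); [left|right].
    by case=> -[/andP[hx _] Bx]; split.
  apply/seteqP; split=> // x /= [[/andP[_ /eqP h1] _] [/andP[_ /eqP h2] _]].
  by rewrite h1 in h2.
have := IHk c; have := splitS E mE; have := splitS setT measurableT.
rewrite !setIT SE => -> -> hk.
have infE := event_influence_tail c k tE; rewrite /event_influence -/(S _) in
  infE.
have S0 b := pr_ge0 P (S b).
have SE0 b : 0 <= pr (S b `&` E) by exact: pr_ge0.
have SEle b : pr (S b `&` E) <= pr (S b).
  by apply: pr_le => [||x [] //] //; exact: measurableI.
(* This sum is the probability of the prefix of length [k]; if it is 0, both sides vanish. *)
have [s0|s_neq0] := eqVneq (pr (S true) + pr (S false)) 0.
  have h1 := S0 true; have h2 := S0 false; have h3 := S0 (c k).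
  have p0 : pr (S (c k)) = 0 by case: (c k); lra.
  have := SEle (c k); have := SE0 (c k); rewrite p0 mul0r => ? ?; lra.
apply: (mulfI s_neq0); rewrite mulrCA -hk.
by case: (c k); lra.
Qed.

(** A cylinder is a finite disjoint union of prefix events. *)
Lemma tail_independent_cyl E N g : tail_sigma_field X E -> depends_on 0 N g ->
  pr (cyl g `&` E) = pr (cyl g) * pr E.
Proof.
move=> tE dg; have mE := tail_measurable tE.
pose atoms (s : seq (N.-tuple bool)) := [set x | has (fun I =>
  starts_with (tuple_path I) N (trajectory X x)) s].
suff h s : uniq s -> measurable (atoms s) /\ pr (atoms s `&` E) = pr (atoms s)
  * pr E.
  have -> : cyl g = atoms (enum [pred I : N.-tuple bool | g (tuple_path I)]).
    apply/seteqP; split=> x /=.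
      move=> gx; apply/hasP; exists (prefix_vector X N x).
        rewrite mem_enum inE (dg _ (trajectory X x)) // => i /andP[_ iN].
        by rewrite /tuple_path -(tnth_nth _ _ (Ordinal iN)) tnth_mktuple.
      by apply/forallP => i; rewrite /tuple_path -(tnth_nth _ _ i) tnth_mktuple.
    move=> /hasP[I]; rewrite mem_enum inE => gI /forallP hI.
    suff : g (trajectory X x) by [].
    rewrite (dg _ (tuple_path I)) // => i /andP[_ iN].
    exact/eqP/(hI (Ordinal iN)).
  exact: proj2 (h _ (enum_uniq [pred I : N.-tuple bool | g (tuple_path I)])).
elim: s => [_|I s IHs /= /andP[Is /IHs[ms prs]]].
  have -> : atoms [::] = set0 by rewrite -subset0 => x.
  by rewrite set0I pr_set0 mul0r; split.
pose A := cyl (starts_with (tuple_path I) N).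
have mA : measurable A.
  exact: measurable_cyl (@depends_on_starts_with (tuple_path I) N).
have -> : atoms (I :: s) = A `|` atoms s.
  by apply/seteqP; split=> x /=; [move/orP|move=> ?; apply/orP].
have As0 : A `&` atoms s = set0.
  apply/seteqP; split=> // x [/forallP hI /hasP[J Js /forallP hJ]].
  have IJ : I = J.
    apply: eq_from_tnth => i; rewrite !(tnth_nth false).
    exact: etrans (esym (eqP (hI i))) (eqP (hJ i)).
  by rewrite IJ Js in Is.
split; first exact: measurableU.
rewrite setIUl !prU //; [|exact: measurableI|exact: measurableI|].
  by rewrite prs tail_independent_prefix // mulrDl.
by rewrite setIACA As0 set0I.
Qed.

(** [E] is a limit of cylinders, all independent of [E], so it is independent of itself. *)
Lemma tail_trivial E : tail_sigma_field X E -> pr E = 0 \/ pr E = 1.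
Proof.
move=> tE; have mE := tail_measurable tE.
have sq : pr E = pr E * pr E.
  apply/eqP; rewrite -subr_eq0 -normr_eq0 eq_le normr_ge0 andbT.
  apply/ler_addgt0Pl => eps eps0; rewrite addr0.
  have eps2 : 0 < eps / 2 by rewrite divr_gt0.
  have [_ /(_ _ eps2)[N [g [dg hg]]]] := sigma_from_approximable (tE 0%N I).
  have mg := measurable_cyl X dg.
  have h1 := pr_sym_diff P mE mg mE.
  have h2 := pr_sym_diff P mE mg measurableT.
  rewrite setIid [E `&` cyl g]setIC (tail_independent_cyl tE dg) in h1.
  rewrite !setTI in h2.
  have E1 : pr E <= 1 by rewrite -(pr_setT P); apply: pr_le.
  have h3 : `|(pr E - pr (cyl g)) * pr E| <= eps / 2.
    rewrite normrM (ger0_norm (pr_ge0 P E)) -[leRHS]mulr1 ler_pM ?pr_ge0 //.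
    exact: le_trans h2 hg.
  have -> : pr E - pr E * pr E =
      (pr E - pr (cyl g) * pr E) - (pr E - pr (cyl g)) * pr E by ring.
  rewrite (le_trans (ler_normB _ _)) // [leRHS]splitr lerD //.
  exact: le_trans h1 hg.
have [->|E0] := eqVneq (pr E) 0; [by left|right].
by apply: (mulfI E0); rewrite mulr1 -sq.
Qed.

End TailTriviality.

Theorem corollary2p6 (d : measure_display) (T : measurableType d)
  (R : realType) (P : probability T R) (X : nat -> {RV P >-> bool})
  (hX : strongly_rayleigh_sequence X) (E : set T) (hE : tail_sigma_field X E) :
  P E = 0%E \/ P E = 1%E.
Proof.
rewrite (prE P (tail_measurable hE)).
by have [->|->] := tail_trivial hX hE; [left|right].
Qed.
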